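(* Let $\mathcal{H}$ be a complex Hilbert space. For $T\in\mathcal{B}(\mathcal{H})$ the following statements are equivalent: (i) $T$ is expansive and has a minimal $2$-isometric lifting of type I; (ii) $T$ is an $A$-contraction for some $A\in\mathcal{B}(\mathcal{H})$ such that $A\ge\Delta_T\ge0$; (iii) $T$ has an extension $\widetilde{T}$, defined on a Hilbert space $\mathcal{K}$, which on an orthogonal decomposition $\mathcal{K}=\mathcal{K}_0\oplus\mathcal{K}_1$ has the form $$\widetilde{T}=\begin{pmatrix}V&\delta E\\0&U\end{pmatrix},$$ with $V$ an isometry on $\mathcal{K}_0$, $U$ a unitary operator on $\mathcal{K}_1$, $E$ a contraction from $\mathcal{K}_1$ into $\mathcal{K}_0$ satisfying $V^*E=0$, and $\delta\ge\|\Delta_T\|^{1/2}$. Moreover, if these statements are true, then one can choose $\widetilde{T}$ in (iii) with $\delta=\|A\|^{1/2}$ for $A$ as in (ii).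
   Context: All Hilbert spaces are complex and operators are bounded and linear. $\Delta_T=T^*T-I$, and $T$ is expansive if $T^*T\ge I$. $S$ is a $2$-isometry if $S^{*2}S^2-2S^*S+I=0$. If $\mathcal{H}$ is a closed subspace of $\mathcal{K}'$, $S\in\mathcal{B}(\mathcal{K}')$ is a lifting of $T\in\mathcal{B}(\mathcal{H})$ if $P_{\mathcal{H}}S=TP_{\mathcal{H}}$; it is minimal if $\mathcal{K}'=\bigvee_{n\ge0}S^n\mathcal{H}$. A $2$-isometric lifting $S$ of $T$ is of type I if $\mathcal{K}'\ominus\mathcal{H}\subset\mathcal{N}(\Delta_S)$ (equivalently, $S|_{\mathcal{K}'\ominus\mathcal{H}}$ is an isometry). An operator $\widetilde{T}$ on $\mathcal{K}$ is an extension of $T$ if there is an isometry $Z:\mathcal{H}\to\mathcal{K}$ with $ZT=\widetilde{T}Z$ (so $\mathcal{H}$ is identified with the invariant subspace $Z\mathcal{H}$). For $A\ge0$, $T$ is an $A$-contraction if $T^*AT\le A$. *)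

(* Defs.v *)
From HB Require Import structures.
From mathcomp Require Import all_boot all_order all_algebra.
From mathcomp Require Import all_classical all_reals all_analysis.
From mathcomp Require Import complex.

Set Implicit Arguments.
Unset Strict Implicit.
Unset Printing Implicit Defensive.

Import Order.TTheory GRing.Theory Num.Theory.
Import numFieldNormedType.Exports.

Local Open Scope classical_set_scope.
Local Open Scope ring_scope.
Local Open Scope complex_scope.

(* The inner product is linear in its first argument and conjugate-linear in
   the second one. *)
HB.mixin Record CompleteNormedModule_isHilbert (R : realType) H
    of CompleteNormedModule R[i] H := {
  ip : {dot H for @Num.conj R[i]} ;
  ip_norm : forall x : H, ip x x = `|x| ^+ 2
}.

#[short(type="hilbertType")]
HB.structure Definition Hilbert (R : realType) :=
  {H of CompleteNormedModule R[i] H & CompleteNormedModule_isHilbert R H}.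

Arguments ip {R} s.

Notation "''[' u , v ]" := (ip _ u v) : ring_scope.

(* For linear maps between normed modules, continuity is boundedness, see
   linear_bounded_continuous. *)
#[short(type="boundedOp")]
HB.structure Definition BoundedOp (R : realType) (H K : hilbertType R) :=
  {f of @GRing.Linear R[i] H K *:%R f & @isContinuous H K f}.

Notation "''B(' H , K )" := (boundedOp H%type K%type)
  (format "''B(' H ,  K )") : type_scope.
Notation "''B(' H )" := (boundedOp H%type H%type)
  (format "''B(' H )") : type_scope.

Section operators.
Variable R : realType.
Implicit Types H K : hilbertType R.

(* By the Riesz representation theorem, for T in 'B(H, K) the vector z below
   exists and is unique; the default value 0 is then irrelevant. *)
Definition adj H K (T : H -> K) : K -> H := fun y =>
  xget 0 [set z | forall x : H, '[T x, y] = '[x, z]].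

Definition Delta H (T : H -> H) : H -> H := adj T \o T \- idfun.

(* The order of R[i] makes 0 <= z imply that z is real. *)
Definition op_le H (A B : H -> H) := forall x : H, 0 <= '[B x - A x, x].

(* The elements of the set are real, so that Re only changes their type. *)
Definition opnorm H K (T : H -> K) : R :=
  sup [set complex.Re `|T x| | x in [set x : H | `|x| <= 1]].

Definition expansive H (T : H -> H) := op_le idfun (adj T \o T).

Definition A_contraction H (A T : H -> H) :=
  op_le \0 A /\ op_le (adj T \o A \o T) A.

Definition is_isometry H K (V : H -> K) := forall x : H, `|V x| = `|x|.

Definition is_contraction_op H K (E : H -> K) := opnorm E <= 1.

Definition is_unitary_op H (U : H -> H) :=
  adj U \o U =1 idfun /\ U \o adj U =1 idfun.

Definition two_isometry H (S : H -> H) := forall x : H,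
  adj S (adj S (S (S x))) - 2 *: adj S (S x) + x = 0.

Definition null_space H K (T : H -> K) : set H := [set x | T x = 0].

Definition ortho_compl H (M : set H) : set H :=
  [set x | forall y, M y -> '[x, y] = 0].

Definition closed_subspace H (M : set H) :=
  GRing.submod_closed [in M] /\ closed M.

Definition closed_span H (X : set H) : set H :=
  smallest (@closed_subspace H) X.

(* H is a closed subspace of K through the isometry J : H -> K. The orthogonal
   projection of K onto range J, read as a map from K to H, is adj J. *)

Definition is_lifting H K (J : H -> K) (T : H -> H) (S : K -> K) :=
  adj J \o S =1 T \o adj J.

Definition minimal_lifting H K (J : H -> K) (S : K -> K) :=
  closed_span (\bigcup_n (iter n S @` range J)) = setT.

Definition type_I H K (J : H -> K) (S : K -> K) :=
  ortho_compl (range J) `<=` null_space (Delta S).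

Definition has_min_2iso_lifting_type_I H (T : 'B(H)) :=
  exists (K : hilbertType R) (J : 'B(H, K)) (S : 'B(K)),
    [/\ is_isometry J, is_lifting J T S, two_isometry S,
        minimal_lifting J S & type_I J S].

Definition is_extension H K (T : H -> H) (T' : K -> K) :=
  exists Z : 'B(H, K), is_isometry Z /\ Z \o T =1 T' \o Z.

(* K is the orthogonal sum of the closed subspaces range J0 and range J1. *)
Definition ortho_decomposition K0 K1 K (J0 : K0 -> K) (J1 : K1 -> K) :=
  [/\ is_isometry J0, is_isometry J1,
      (forall x y, '[J0 x, J1 y] = 0) &
      forall k, exists x y, k = J0 x + J1 y].

Definition block_upper K0 K1 K (J0 : K0 -> K) (J1 : K1 -> K)
    (T' : K -> K) (V : K0 -> K0) (W : K1 -> K0) (U : K1 -> K1) :=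
  forall x y, T' (J0 x + J1 y) = J0 (V x + W y) + J1 (U y).

Definition has_block_extension H (T : 'B(H)) (delta : R) :=
  exists (K0 K1 K : hilbertType R) (J0 : 'B(K0, K)) (J1 : 'B(K1, K))
    (T' : 'B(K)) (V : 'B(K0)) (E : 'B(K1, K0)) (U : 'B(K1)),
    [/\ is_extension T T', ortho_decomposition J0 J1,
        block_upper J0 J1 T' V (delta%:C \*: E) U &
        [/\ is_isometry V, is_unitary_op U, is_contraction_op E,
            adj V \o E =1 \0 & Num.sqrt (opnorm (Delta T)) <= delta]].

End operators.

(* Main.v *)
Require Import Defs.
From HB Require Import structures.
From mathcomp Require Import all_boot all_order all_algebra.
From mathcomp Require Import all_classical all_reals all_analysis.
From mathcomp Require Import complex.
From mathcomp Require Import ring lra.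

(** The three statements are all equivalent to the existence of an _invariant_
    majorant: a positive [A] with [T^*AT = A] and [0 <= Delta T <= A].

    If [S] is a 2-isometric lifting of type I then the compression of [Delta S]
    to [H] is such an [A], because [S^*(Delta S)S = Delta S] and [Delta S] lives
    on [H] only ([majorant_of_lifting]). If [T'] is a block extension and [Z1] is
    the component of [H] in [K_1], then [delta^2 Z1^* Z1] is such an [A], because
    [T'] acts on that component by a unitary operator
    ([majorant_of_block_extension]).

    Conversely, from an invariant [A] one builds the lifting by adding to [T] a
    component [X] with [X^*X = A - Delta T] followed by a shift
    ([typeI_dilation], [lifting_of_majorant]). For the block extension, with
    [A <= delta^2], the form [A / delta^2] gives the component of [H] in [K_1]
    and [1 - A / delta^2] the component in [K_0]; invariance and the identity
    [||T h||^2 = ||h||^2 + <Delta T h, h>] say exactly that the prescribed block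
    entries are isometric where they are defined, and they are then extended to
    isometries and unitaries ([block_extension_of_majorant]).

    What remains is to pass from [T^*AT <= A] to equality without leaving the
    interval between [A] and [||A||]; this is where [delta = ||A||^(1/2)] comes
    from. Since [T] is expansive, [c - A] with [c = ||A||] satisfies
    [T^*(c - A)T >= (c - A) + (A - T^*AT)], which allows the defect [A - T^*AT]
    to be pushed back along [T] by a contraction and summed up inside [c - A]
    ([invariant_majorant]).

    Two devices keep the Hilbert space theory small. A positive operator [A] on
    [H] is factored as [Z^*Z] with [Z : H -> l2 H] by iterating [A |-> A - A^2]
    ([factor]), instead of taking a square root. And all dilations take place on
    [L = l2 H], which is unitarily equivalent to the sum of two copies of itself
    ([splitting]). *)

Set Implicit Arguments.
Unset Strict Implicit.
Unset Printing Implicit Defensive.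

Import Order.TTheory GRing.Theory Num.Theory.
Import numFieldNormedType.Exports.

Local Open Scope classical_set_scope.
Local Open Scope ring_scope.
Local Open Scope complex_scope.

(** * The real part of the inner product *)

Section ComplexParts.
Variable R : realType.
Implicit Types (c : R) (z w : R[i]).

Lemma Re_realM c z : complex.Re (c%:C * z) = c * complex.Re z.
Proof. by case: z => a b /=; rewrite mul0r subr0. Qed.

Lemma mul_iJi z : 'i * (('i : R[i])^*%C * z) = z.
Proof. by case: z => a b /=; congr Complex; ring. Qed.

Lemma mulJi z : ('i : R[i])^*%C * z = Complex (complex.Im z) (- complex.Re z).
Proof. by case: z => a b /=; congr Complex; ring. Qed.

Lemma ReJ z : complex.Re z^*%C = complex.Re z.
Proof. by case: z. Qed.

End ComplexParts.

Section RealInnerProduct.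
Variable R : realType.
Implicit Types H K : hilbertType R.

(** All norm computations are carried out in [R] with the real inner product
    [rip] and the squared norm [nsq]; [ipE] recovers the complex inner product
    from [rip]. *)
Definition rip H (x y : H) : R := complex.Re '[x, y].

Definition nsq H (x : H) : R := rip x x.

Lemma ripDl H (x y z : H) : rip (x + y) z = rip x z + rip y z.
Proof. by rewrite /rip linearDl raddfD. Qed.

Lemma ipC H (x y : H) : '[x, y] = ('[y, x])^*%C.
Proof. by rewrite (hermC (ip H)) expr0 mul1r. Qed.

Lemma ripC H (x y : H) : rip x y = rip y x.
Proof. by rewrite /rip ipC ReJ. Qed.

Lemma ripDr H (x y z : H) : rip x (y + z) = rip x y + rip x z.
Proof. by rewrite ripC ripDl !(ripC x). Qed.

Lemma ripZl H (c : R) (x y : H) : rip (c%:C *: x) y = c * rip x y.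
Proof. by rewrite /rip linearZl_LR Re_realM. Qed.

Lemma ripZr H (c : R) (x y : H) : rip x (c%:C *: y) = c * rip x y.
Proof. by rewrite ripC ripZl ripC. Qed.

Lemma ripii H (x y : H) : rip ('i *: x) ('i *: y) = rip x y.
Proof.
by rewrite /rip linearZl_LR linearZr_LR /= -[Num.conj _]/(conjc _) mul_iJi.
Qed.

Lemma rip0l H (x : H) : rip 0 x = 0.
Proof. by have := ripZl 0 0 x; rewrite scaler0 mul0r. Qed.

Lemma rip0r H (x : H) : rip x 0 = 0.
Proof. by rewrite ripC rip0l. Qed.

Lemma ripNl H (x y : H) : rip (- x) y = - rip x y.
Proof. by apply/eqP; rewrite -addr_eq0 -ripDl addNr rip0l. Qed.

Lemma ripNr H (x y : H) : rip x (- y) = - rip x y.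
Proof. by rewrite ripC ripNl ripC. Qed.

Lemma ripBl H (x y z : H) : rip (x - y) z = rip x z - rip y z.
Proof. by rewrite ripDl ripNl. Qed.

Lemma ripBr H (x y z : H) : rip x (y - z) = rip x y - rip x z.
Proof. by rewrite ripDr ripNr. Qed.

Lemma ripil H (x y : H) : rip ('i *: x) y = - rip x ('i *: y).
Proof.
have {1}-> : y = - ('i *: ('i *: y)).
  by rewrite scalerA -expr2 sqr_i scaleN1r opprK.
by rewrite ripNr ripii.
Qed.

Lemma ipE H (x y : H) : '[x, y] = Complex (rip x y) (rip x ('i *: y)).
Proof.
rewrite /rip linearZr_LR /= -[Num.conj _]/(conjc _) mulJi.
by case: '[x, y].
Qed.

Lemma nsq_norm H (x : H) : (nsq x)%:C = `|x| ^+ 2.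
Proof.
by rewrite /nsq /rip (ip_norm x) RRe_real.
Qed.

Lemma nsq_ge0 H (x : H) : 0 <= nsq x.
Proof. by rewrite -ler0c nsq_norm exprn_ge0. Qed.

Lemma norm_sqrt H (x : H) : `|x| = (Num.sqrt (nsq x))%:C.
Proof.
apply/eqP; rewrite -(@eqrXn2 _ 2) //; last by rewrite ler0c sqrtr_ge0.
by rewrite -nsq_norm -rmorphXn /= sqr_sqrtr // nsq_ge0.
Qed.

Lemma nsq_eq0 H (x : H) : (nsq x = 0) <-> (x = 0).
Proof.
split=> [h|->]; last exact: rip0l.
by apply/eqP; rewrite -normr_eq0 norm_sqrt h sqrtr0.
Qed.

Lemma nsq_le0 H (x : H) : nsq x <= 0 -> x = 0.
Proof. by move=> h; apply/nsq_eq0; apply/eqP; rewrite eq_le h nsq_ge0. Qed.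

Lemma nsqD H (x y : H) : nsq (x + y) = nsq x + nsq y + 2 * rip x y.
Proof. by rewrite /nsq ripDl !ripDr (ripC y x); ring. Qed.

Lemma nsqB H (x y : H) : nsq (x - y) = nsq x + nsq y - 2 * rip x y.
Proof. by rewrite /nsq ripBl !ripBr (ripC y x); ring. Qed.

Lemma nsqN H (x : H) : nsq (- x) = nsq x.
Proof. by rewrite /nsq ripNl ripNr opprK. Qed.

Lemma nsq_subC H (x y : H) : nsq (x - y) = nsq (y - x).
Proof. by rewrite -nsqN opprB. Qed.

Lemma nsqZ H (c : R) (x : H) : nsq (c%:C *: x) = c ^+ 2 * nsq x.
Proof. by rewrite /nsq ripZl ripZr expr2 mulrA. Qed.

Lemma nsqi H (x : H) : nsq ('i *: x) = nsq x.
Proof. exact: ripii. Qed.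

Lemma nsqZc H (a : R[i]) (x : H) :
  nsq (a *: x) = (complex.Re a ^+ 2 + complex.Im a ^+ 2) * nsq x.
Proof.
have -> : a *: x = (complex.Re a)%:C *: x + (complex.Im a)%:C *: ('i *: x).
  by rewrite scalerA -scalerDl mulrC -complexE.
rewrite nsqD !nsqZ nsqi ripZl ripZr.
have -> : rip x ('i *: x) = 0 by have := ripil x x; rewrite ripC; lra.
by ring.
Qed.

Lemma nsqD_le H (x y : H) : nsq (x + y) <= 2 * nsq x + 2 * nsq y.
Proof. by have := nsq_ge0 (x - y); rewrite nsqB nsqD; lra. Qed.

Lemma rip_ext H (y z : H) : (forall x, rip x y = rip x z) -> y = z.
Proof.
move=> h; apply/eqP; rewrite -subr_eq0; apply/eqP/nsq_eq0.
by rewrite /nsq ripBr h subrr.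
Qed.

Lemma ip_ext H (y z : H) : (forall x, '[x, y] = '[x, z]) -> y = z.
Proof. by move=> h; apply: rip_ext => x; rewrite /rip h. Qed.

Lemma is_isometryP H K (V : H -> K) :
  is_isometry V <-> forall x, nsq (V x) = nsq x.
Proof.
split=> h x; last by rewrite !norm_sqrt h.
by apply: complexI; rewrite !nsq_norm h.
Qed.

End RealInnerProduct.

(** Every Cauchy--Schwarz inequality below comes from this discriminant bound. *)
Lemma quadratic_discr (R : realFieldType) (a b c : R) : 0 <= c ->
  (forall t, 0 <= a + 2 * t * b + t ^+ 2 * c) -> b ^+ 2 <= a * c.
Proof.
rewrite le_eqVlt => /orP[/eqP<-|c0] h.
  have [->|b0] := eqVneq b 0; first by rewrite expr0n mulr0.
  have := h (- (a + 1) / (2 * b)); have -> : 2 * (- (a + 1) / (2 * b)) * b = - (a + 1).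
    by field.
  by rewrite mulr0; lra.
have := h (- b / c); have -> : a + 2 * (- b / c) * b + (- b / c) ^+ 2 * c = (a * c - b ^+ 2) / c.
  by field; rewrite gt_eqF.
by rewrite pmulr_lge0 ?invr_gt0 // subr_ge0.
Qed.

Lemma rip_CS (R : realType) (H : hilbertType R) (x y : H) :
  rip x y ^+ 2 <= nsq x * nsq y.
Proof.
apply: quadratic_discr (nsq_ge0 _) _ => t.
by have := nsq_ge0 (x + t%:C *: y); rewrite nsqD nsqZ ripZr; lra.
Qed.

(** * Bounded linear maps and convergence *)

Section BoundedMaps.
Variable R : realType.
Implicit Types H K : hilbertType R.

(** Bounded linear maps as a property of plain functions: composites and sums
    are then handled without building a new bundled operator each time. *)
Definition bop H K (f : H -> K) :=
  linear f /\ exists M : R, forall x, nsq (f x) <= M * nsq x.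

Lemma norm_lt_nsq H (x : H) (e : R) : 0 < e ->
  (`|x| < e%:C) = (nsq x < e ^+ 2).
Proof.
move=> e0; rewrite norm_sqrt ltcR -(@ltr_pXn2r _ 2) ?nnegrE ?sqrtr_ge0 ?ltW //.
by rewrite sqr_sqrtr // nsq_ge0.
Qed.

Lemma gt0_complexP (e : R[i]) : 0 < e -> exists2 r : R, 0 < r & e = r%:C.
Proof.
move=> e0; have er : e \is Num.real by rewrite realE ltW.
by exists (complex.Re e); rewrite ?RRe_real // -ltcR RRe_real.
Qed.

Definition nsq_cvg H (u : nat -> H) (l : H) :=
  forall e : R, 0 < e -> exists N, forall n, (N <= n)%N -> nsq (u n - l) < e.

Lemma nsq_complete H (u : nat -> H) :
  (forall e : R, 0 < e -> exists N, forall m n, (N <= m)%N -> (N <= n)%N ->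
     nsq (u m - u n) < e) -> exists l, nsq_cvg u l.
Proof.
move=> hu; have cu : cauchy (u @ \oo).
  apply/cauchyP => _ /gt0_complexP[e e0 ->].
  have [N hN] := hu _ (exprn_gt0 2 e0).
  exists (u N); exists N => // n /= Nn.
  by rewrite -ball_normE /ball_ /= norm_lt_nsq // hN.
have hl : u @ \oo --> lim (u @ \oo) by exact: cauchy_cvg cu.
exists (lim (u @ \oo)) => e e0.
have se0 : 0 < (Num.sqrt e)%:C by rewrite ltcR sqrtr_gt0.
have [N _ hN] := (proj1 (cvgrPdist_lt _ _) hl) _ se0.
exists N => n Nn; have := hN n Nn; rewrite norm_lt_nsq ?sqrtr_gt0 //.
by rewrite sqr_sqrtr ?ltW // nsq_subC.
Qed.

Lemma bop_continuous H K (f : H -> K) : bop f -> continuous f.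
Proof.
case=> lf [M hM]; pose L := GRing.isLinear.Build _ _ _ _ f lf.
pose g : {linear H -> K} := HB.pack f L.
apply: (@bounded_linear_continuous _ _ _ g).
apply/linear_boundedP; exists (Num.sqrt `|M|)%:C; split; first by apply/complex_realP; exists (Num.sqrt `|M|).
move=> r Mr x /=; apply: (@le_trans _ _ ((Num.sqrt `|M|)%:C * `|x|)).
  rewrite !norm_sqrt -rmorphM /= lecR -sqrtrM //.
  apply: ler_wsqrtr; apply: le_trans (hM x) _.
  by rewrite ler_wpM2r ?nsq_ge0 ?ler_norm.
by rewrite ler_wpM2r ?normr_ge0 // ltW.
Qed.

Lemma boundedOp_bop H K (f : 'B(H, K)) : bop f.
Proof.
split; first exact: linearP.
have /linear_bounded_continuous/linear_boundedP : continuous f by exact: cts_fun.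
move=> [M [Mreal hM]].
have [m mE] : exists m : R, M = m%:C by apply/complex_realP.
have M1 : M < (`|m| + 1)%:C.
  by rewrite mE ltcR; have := ler_norm m; lra.
exists ((`|m| + 1) ^+ 2) => x; have := hM _ M1 x.
rewrite !norm_sqrt -rmorphM /= lecR => h.
have m0 : 0 <= `|m| + 1 by rewrite addr_ge0.
rewrite -[nsq (f x)]sqr_sqrtr ?nsq_ge0 // -[nsq x]sqr_sqrtr ?nsq_ge0 //.
by rewrite -exprMn ler_pXn2r // nnegrE ?mulr_ge0 ?sqrtr_ge0.
Qed.

(** Since [BoundedOp] coerces to functions, [toB hf] is convertible to [f] as a
    function: nothing proved about [f] has to be transported. *)
Definition toB H K (f : H -> K) (hf : bop f) : 'B(H, K) :=
  let L := GRing.isLinear.Build _ _ _ _ f hf.1 in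
  let C := isContinuous.Build _ _ f (bop_continuous hf) in
  HB.pack f L C.

Lemma closed_nsqP H (M : set H) : closed M <->
  forall x, (forall e : R, 0 < e -> exists2 y, M y & nsq (x - y) < e) -> M x.
Proof.
split=> [cM x hx|h].
  apply: cM => B /nbhs_ballP[_ /= /gt0_complexP[e e0 ->] eB].
  have [y My xy] := hx _ (exprn_gt0 2 e0).
  by exists y; split=> //; apply: eB; rewrite -ball_normE /ball_ /= norm_lt_nsq.
move=> x cx; apply: h => e e0.
have se0 : 0 < Num.sqrt e by rewrite sqrtr_gt0.
have : nbhs x (ball x (Num.sqrt e)%:C) by apply: nbhsx_ballx; rewrite ltcR.
move=> /cx[y [My]]; rewrite -ball_normE /ball_ /= norm_lt_nsq //.
by rewrite sqr_sqrtr ?ltW // => ?; exists y.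
Qed.

End BoundedMaps.

(** * Riesz representation and adjoints *)

Section LinearFunctions.
Variables (K : pzRingType) (U V : lmodType K) (f : U -> V).
Hypothesis lf : linear f.

Lemma linD x y : f (x + y) = f x + f y.
Proof. by have := lf 1 x y; rewrite !scale1r. Qed.

Lemma lin0 : f 0 = 0.
Proof. by apply: (addrI (f 0)); rewrite -linD !addr0. Qed.

Lemma linZ a x : f (a *: x) = a *: f x.
Proof. by have := lf a x 0; rewrite lin0 !addr0. Qed.

Lemma linN x : f (- x) = - f x.
Proof. by rewrite -scaleN1r linZ scaleN1r. Qed.

Lemma linB x y : f (x - y) = f x - f y.
Proof. by rewrite linD linN. Qed.

End LinearFunctions.

Section BopAlgebra.
Variable R : realType.
Implicit Types H K L : hilbertType R.

Lemma bopI H K (f : H -> K) (M : R) :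
  linear f -> (forall x, nsq (f x) <= M * nsq x) -> bop f.
Proof. by move=> lf hM; split=> //; exists M. Qed.

Lemma bop_id H : bop (fun x : H => x).
Proof. by apply: (@bopI _ _ _ 1) => // x; rewrite mul1r. Qed.

Lemma bop_comp H K L (f : K -> L) (g : H -> K) :
  bop f -> bop g -> bop (fun x => f (g x)).
Proof.
move=> [lf [M hM]] [lg [N hN]].
apply: (@bopI _ _ _ (`|M| * N)) => [a x y|x]; first by rewrite lg lf.
apply: le_trans (hM _) _; apply: (@le_trans _ _ (`|M| * nsq (g x))).
  by rewrite ler_wpM2r ?nsq_ge0 // ler_norm.
by rewrite -mulrA ler_wpM2l.
Qed.

Lemma bopD H K (f g : H -> K) : bop f -> bop g -> bop (fun x => f x + g x).
Proof.
move=> [lf [M hM]] [lg [N hN]].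
apply: (@bopI _ _ _ (2 * M + 2 * N)) => [a x y|x].
  by rewrite lf lg scalerDr addrACA.
by apply: le_trans (nsqD_le _ _) _; have := hM x; have := hN x; lra.
Qed.

Lemma bopZ H K (c : R) (f : H -> K) : bop f -> bop (fun x => c%:C *: f x).
Proof.
move=> [lf [M hM]]; apply: (@bopI _ _ _ (c ^+ 2 * M)) => [a x y|x].
  by rewrite lf scalerDr !scalerA mulrC.
by rewrite nsqZ -mulrA ler_wpM2l ?sqr_ge0.
Qed.

Lemma bopB H K (f g : H -> K) : bop f -> bop g -> bop (fun x => f x - g x).
Proof.
move=> hf hg; have := bopD hf (bopZ (-1) hg).
by congr bop; apply/funext => x; rewrite rmorphN rmorph1 scaleN1r.
Qed.

Lemma bop_isometry H K (f : H -> K) :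
  linear f -> (forall x, nsq (f x) = nsq x) -> bop f.
Proof. by move=> lf h; apply: (@bopI _ _ _ 1) => // x; rewrite h mul1r. Qed.

End BopAlgebra.

Section Riesz.
Variable R : realType.
Implicit Types H K L : hilbertType R.

Lemma small_inv (e : R) : 0 < e -> exists N, forall n, (N <= n)%N -> n.+1%:R^-1 < e.
Proof.
move=> e0; have [N _ hN] := near_infty_natSinv_lt (PosNum e0).
by exists N => n Nn; exact: hN.
Qed.

Lemma le0_small (a c : R) : 0 <= c -> (forall e : R, 0 < e -> a <= e * c) -> a <= 0.
Proof.
move=> c0 h; rewrite leNgt; apply/negP => a0.
have e0 : 0 < a / (2 * (c + 1)) by rewrite divr_gt0 //; lra.
have := h _ e0; rewrite mulrAC ler_pdivlMr; last by lra.
have := mulr_ge0 (ltW a0) c0; nra.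
Qed.

Lemma eq0_small (a c : R) : 0 <= c -> (forall e : R, 0 < e -> a ^+ 2 <= e * c) -> a = 0.
Proof.
move=> c0 h; apply/eqP; rewrite -sqrf_eq0 eq_le sqr_ge0 andbT.
exact: le0_small c0 h.
Qed.

(** The Riesz representation of a functional of the form [v |-> f v] which is
    dominated by [v |-> ||Z v||]. The minimizing sequence of
    [||Z v||^2 - 2 f v] is Cauchy after applying [Z], and the representing
    vector is its limit. With [Z] the identity this is the Riesz theorem; with
    [f v = <Z v, k>] it is the orthogonal projection of [k] onto the closure of
    the range of [Z]. *)
Lemma riesz_range (V : lmodType R[i]) K (Z : V -> K) (f : V -> R) (M : R) :
  linear Z -> {morph f : u v / u + v} ->
  (forall c v, f (c%:C *: v) = c * f v) ->
  (forall v, f v ^+ 2 <= M * nsq (Z v)) ->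
  exists z : K, (forall v, f v = rip (Z v) z) /\
    forall e : R, 0 < e -> exists v, nsq (Z v - z) < e.
Proof.
move=> lZ fD fZ fM.
have fN v : f (- v) = - f v.
  by have := fZ (-1) v; rewrite rmorphN1 scaleN1r mulN1r.
(* A minimizer of phi would be a preimage of the representing vector under Z. *)
pose phi v := nsq (Z v) - 2 * f v.
have phi_lb v : - `|M| <= phi v.
  have h : f v ^+ 2 <= `|M| * nsq (Z v).
    by apply: le_trans (fM v) _; rewrite ler_wpM2r ?nsq_ge0 ?ler_norm.
  have : 2 * f v <= nsq (Z v) + `|M|.
    have s0 : 0 <= nsq (Z v) + `|M| by rewrite addr_ge0 ?nsq_ge0.
    case: (leP (f v) 0) => f0; first by lra.
    rewrite -(@ler_pXn2r _ 2) ?nnegrE //; last by lra.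
    by have := sqr_ge0 (nsq (Z v) - `|M|); nra.
  by rewrite /phi; lra.
pose m := inf (range phi).
have hi : has_inf (range phi).
  by split; [exists (phi 0), 0 | exists (- `|M|) => _ [v _ <-]].
have m_le v : m <= phi v by apply: ge_inf; [exact: hi.2 | exists v].
have ex_v (n : nat) : exists v, phi v < m + n.+1%:R^-1.
  have n0 : 0 < n.+1%:R^-1 :> R by rewrite invr_gt0 ltr0n.
  by have [_ [v _ <-] hv] := inf_adherent n0 hi; exists v.
have [v hv] := choice ex_v.
have phiE u w t : phi (u + t%:C *: w) =
    phi u + 2 * t * (rip (Z u) (Z w) - f w) + t ^+ 2 * nsq (Z w).
  by rewrite /phi (linD lZ) (linZ lZ) fD fZ nsqD nsqZ ripZr; ring.
have [|z hz] := nsq_complete (u := Z \o v).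
  move=> e e0; have [N hN] := small_inv (divr_gt0 e0 (ltr0Sn _ 3)).
  (* The midpoint of v k and v l is no better than m: parallelogram law. *)
  exists N => k l Nk Nl /=.
  have := m_le (v k + (-1 / 2)%:C *: (v k - v l)).
  have := hv k; have := hv l; have := hN k Nk; have := hN l Nl.
  rewrite phiE fD fN (linB lZ) nsqB ripBr /phi.
  rewrite -[rip (Z (v k)) (Z (v k))]/(nsq _).
  by move: (k.+1%:R^-1) (l.+1%:R^-1) => a b; lra.
exists z; split=> [w|e e0]; last first.
  by have [N hN] := hz e e0; exists (v N); exact: (hN N).
apply/eqP; rewrite eq_sym -subr_eq0; apply/eqP.
apply: (@eq0_small _ (4 * nsq (Z w))).
  by rewrite mulr_ge0 // nsq_ge0.
move=> e e0; have [N1 h1] := hz e e0; have [N2 h2] := small_inv e0.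
pose n := maxn N1 N2.
(* Moving v n in the direction w cannot gain more than 1 / (n + 1). *)
have c1 : (rip (Z (v n)) (Z w) - f w) ^+ 2 <= n.+1%:R^-1 * nsq (Z w).
  apply: quadratic_discr (nsq_ge0 _) _ => t.
  by have := m_le (v n + t%:C *: w); have := hv n; rewrite phiE;
    move: (n.+1%:R^-1) => a; lra.
have c2 := rip_CS (Z (v n) - z) (Z w).
have := h1 n (leq_maxl _ _); have := h2 n (leq_maxr _ _).
rewrite /= => h2n h1n.
have w0 := nsq_ge0 (Z w).
have c3 : n.+1%:R^-1 * nsq (Z w) <= e * nsq (Z w) by rewrite ler_wpM2r // ltW.
have c4 : nsq (Z (v n) - z) * nsq (Z w) <= e * nsq (Z w) by rewrite ler_wpM2r // ltW.
move: c1 c2; rewrite ripBl (ripC (Z w)).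
set p := rip (Z (v n)) _; set q := rip z _ => c1 c2.
have := le_trans c1 c3; have := le_trans c2 c4.
by have := sqr_ge0 ((p - f w) + (p - q)); lra.
Qed.

(** The value of [adj] is pinned down by a Riesz vector of the functional
    [x |-> Re <T x, y>]; the imaginary parts agree because [T] commutes with
    multiplication by [i]. *)
Lemma adj_rip H K (T : H -> K) : bop T ->
  forall x y, rip (T x) y = rip x (adj T y).
Proof.
move=> [lT [M hM]] x y.
have [||c v|v|z [hz _]] := @riesz_range H H id (fun v => rip (T v) y) (`|M| * nsq y).
- by [].
- by move=> u v; rewrite (linD lT) ripDl.
- by rewrite (linZ lT) ripZl.
- apply: le_trans (rip_CS _ _) _; rewrite mulrAC ler_wpM2r ?nsq_ge0 //.
  by apply: le_trans (hM v) _; rewrite ler_wpM2r ?nsq_ge0 ?ler_norm.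
have hip v : '[T v, y] = '[v, z].
  rewrite !ipE -hz; congr Complex.
  by apply: oppr_inj; rewrite -!ripil -hz (linZ lT).
have : [set z | forall x : H, '[T x, y] = '[x, z]] (adj T y).
  by rewrite /adj; case: xgetP => [z' -> //|/(_ z)].
by rewrite /= => h; rewrite /rip h.
Qed.

Lemma rip_adj H K (T : H -> K) : bop T ->
  forall x y, rip (adj T y) x = rip y (T x).
Proof. by move=> hT x y; rewrite ripC -adj_rip // ripC. Qed.

Lemma adj_ip H K (T : H -> K) : bop T ->
  forall x y, '[T x, y] = '[x, adj T y].
Proof.
move=> hT x y; rewrite !ipE -!adj_rip //; congr Complex.
by apply: oppr_inj; rewrite -!ripil -adj_rip // (linZ hT.1).
Qed.

Lemma adj_eq H K (T : H -> K) y z : bop T ->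
  (forall x, rip (T x) y = rip x z) -> adj T y = z.
Proof. by move=> hT h; apply: rip_ext => x; rewrite -h adj_rip. Qed.

Lemma bop_adj H K (T : H -> K) : bop T -> bop (adj T).
Proof.
move=> hT; have [lT [M hM]] := hT.
have lA : linear (adj T).
  move=> a y z; apply: ip_ext => x.
  by rewrite -adj_ip // !linearDr !linearZr_LR /= !adj_ip.
apply: (@bopI _ _ _ _ `|M|) lA _ => y.
have h := rip_CS (T (adj T y)) y; rewrite adj_rip // -/(nsq _) in h.
have [->|n0] := eqVneq (nsq (adj T y)) 0; first by rewrite mulr_ge0 ?nsq_ge0.
have np : 0 < nsq (adj T y) by rewrite lt_def n0 nsq_ge0.
rewrite -(@ler_pM2l _ (nsq (adj T y))) // -expr2; apply: le_trans h _.
rewrite mulrCA mulrA ler_wpM2r ?nsq_ge0 //.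
by apply: le_trans (hM _) _; rewrite ler_wpM2r ?nsq_ge0 ?ler_norm.
Qed.

End Riesz.

(** * Hilbert spaces from real inner products *)

(** A Hilbert space is recovered from the real part of its inner product; it
    suffices that this real form be complete, as the complex inner product is
    [rf x y + i rf x (i y)]. *)
Record realIP (R : realType) (V : lmodType R[i]) := RealIP {
  rf :> V -> V -> R;
  rfDl : forall x y z, rf (x + y) z = rf x z + rf y z;
  rfC : forall x y, rf x y = rf y x;
  rfZl : forall (c : R) x y, rf (c%:C *: x) y = c * rf x y;
  rfii : forall x y, rf ('i *: x) ('i *: y) = rf x y;
  rf_ge0 : forall x, 0 <= rf x x;
  rf_eq0 : forall x, rf x x = 0 -> x = 0;
  rf_complete : forall u : nat -> V,
    (forall e : R, 0 < e -> exists N, forall m n, (N <= m)%N -> (N <= n)%N ->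
       rf (u m - u n) (u m - u n) < e) ->
    exists l, forall e : R, 0 < e ->
      exists N, forall n, (N <= n)%N -> rf (u n - l) (u n - l) < e
}.

(** A copy of [V] which carries the topology defined by [r]; the form is kept as
    a parameter so that the instances below can depend on it. *)
Definition hilb_of (R : realType) (V : lmodType R[i]) (r : realIP V) : Type := V.

Section HilbertOfRealIP.
Variables (R : realType) (V : lmodType R[i]) (r : realIP V).
Local Notation HV := (hilb_of r).

HB.instance Definition _ := GRing.Lmodule.copy HV V.

Let rfDr x y z : r x (y + z) = r x y + r x z.
Proof. by rewrite rfC rfDl !(rfC _ x). Qed.

Let rfZr (c : R) x y : r x (c%:C *: y) = c * r x y.
Proof. by rewrite rfC rfZl rfC. Qed.

Let rf_CS x y : r x y ^+ 2 <= r x x * r y y.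
Proof.
apply: quadratic_discr (rf_ge0 r _) _ => t.
have := rf_ge0 r (x + t%:C *: y).
by rewrite rfDl !rfDr !rfZr !rfZl (rfC r y x); lra.
Qed.

Let rf_sqrE x y : r (x + y) (x + y) = r x x + r y y + 2 * r x y.
Proof. by rewrite rfDl !rfDr (rfC r y x); ring. Qed.

Let rf_subE x y : r (x - y) (x - y) = r x x + r y y - 2 * r x y.
Proof.
have rN a b : r (- a) b = - r a b.
  by have := rfZl r (-1) a b; rewrite rmorphN1 scaleN1r mulN1r.
by rewrite rf_sqrE rN !(rfC r _ (- y)) !rN (rfC r y); ring.
Qed.

Let nrm (x : HV) : R[i] := (Num.sqrt (r x x))%:C.

Let rfN x y : r (- x) y = - r x y.
Proof. by have := rfZl r (-1) x y; rewrite rmorphN1 scaleN1r mulN1r. Qed.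

Let rfiN x y : r ('i *: x) y = - r x ('i *: y).
Proof.
have {1}-> : y = - ('i *: ('i *: y)).
  by rewrite scalerA -expr2 sqr_i scaleN1r opprK.
by rewrite rfC rfN rfC rfii.
Qed.

Let scalerCE (a : R[i]) (x : V) :
  a *: x = (complex.Re a)%:C *: x + (complex.Im a)%:C *: ('i *: x).
Proof. by rewrite scalerA -scalerDl mulrC -complexE. Qed.

Let nrm_tri x y : nrm (x + y) <= nrm x + nrm y.
Proof.
rewrite /nrm -rmorphD /= lecR -(@ler_pXn2r _ 2) ?nnegrE ?addr_ge0 ?sqrtr_ge0 //.
rewrite sqrrD !sqr_sqrtr ?rf_ge0 // rf_sqrE -sqrtrM ?rf_ge0 //.
suff : r x y <= Num.sqrt (r x x * r y y) by rewrite -mulr_natl; lra.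
apply: le_trans (ler_norm _) _; rewrite -sqrtr_sqr.
exact/ler_wsqrtr/rf_CS.
Qed.

Let nrmZ (a : R[i]) x : nrm (a *: x) = `|a| * nrm x.
Proof.
rewrite /nrm normc_def -rmorphM /= -sqrtrM ?addr_ge0 ?sqr_ge0 //.
congr ((Num.sqrt _)%:C); rewrite scalerCE rf_sqrE !rfZl !rfZr rfii.
have -> : r x ('i *: x) = 0.
  by have := rfiN x x; rewrite rfC; lra.
by ring.
Qed.

Let nrm_eq0 x : nrm x = 0 -> x = 0.
Proof.
move=> [] /eqP; rewrite sqrtr_eq0 => h; apply: (rf_eq0 (r := r)).
by apply/eqP; rewrite eq_le h rf_ge0.
Qed.

HB.instance Definition _ :=
  Lmodule_isNormed.Build R[i] HV nrm_tri nrmZ nrm_eq0.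

Let hilb_cauchy (F : set_system HV) : ProperFilter F -> cauchy F -> cvg F.
Proof.
move=> FF /cauchyP cF.
(* The balls of radius 1 / (n + 1) in F provide a Cauchy sequence of centres
   whose limit is the limit of F. *)
have ex n : exists x : HV, F (ball x (n.+1%:R^-1)%:C).
  by apply: cF; rewrite ltcR invr_gt0.
have [u hu] := choice ex.
have nrm_lt (x y : HV) (e : R) : 0 < e -> ball x e%:C y -> r (x - y) (x - y) < e ^+ 2.
  move=> e0; rewrite -ball_normE /ball_ /= ltcR.
  rewrite -(@ltr_pXn2r _ 2) ?nnegrE ?sqrtr_ge0 ?(ltW e0) //.
  by rewrite sqr_sqrtr ?rf_ge0.
have [|l hl] := rf_complete (r := r) (u := u).
  move=> e e0; have e'0 : 0 < Num.min 1 (e / 4) by rewrite lt_min ltr01 divr_gt0.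
  have [N hN] := small_inv e'0.
  exists N => m n Nm Nn.
  have [z [zm zn]] := filter_ex (filterI (hu m) (hu n)).
  have hm := nrm_lt _ _ _ _ zm; have hn := nrm_lt _ _ _ _ zn.
  have := hN m Nm; have := hN n Nn; rewrite !lt_min => /andP[n1 n2] /andP[m1 m2].
  have m0 : 0 < m.+1%:R^-1 :> R by rewrite invr_gt0.
  have n0 : 0 < n.+1%:R^-1 :> R by rewrite invr_gt0.
  have := hm m0; have := hn n0.
  have : m.+1%:R^-1 ^+ 2 < e / 4 by apply: lt_trans m2; rewrite expr2 gtr_pMl.
  have : n.+1%:R^-1 ^+ 2 < e / 4 by apply: lt_trans n2; rewrite expr2 gtr_pMl.
  move: (hm m0) (hn n0); have -> : u m - u n = (u m - z) - (u n - z).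
    by rewrite opprB addrA subrK.
  move: (u m - z) (u n - z) => p q hp hq ha hb.
  have := rf_ge0 r (p + q); rewrite rf_subE rf_sqrE.
  have := lt_trans hp hb; have := lt_trans hq ha; lra.
apply/cvg_ex; exists l; apply/cvgrPdist_lt => _ /gt0_complexP[e e0 ->].
have e2 : 0 < (e / 2) ^+ 2 by rewrite exprn_gt0 // divr_gt0.
have e'0 : 0 < e / 2 by rewrite divr_gt0.
have [N1 h1] := hl _ e2; have [N2 h2] := small_inv e'0.
have := h1 _ (leq_maxl N1 N2); have := h2 _ (leq_maxr N1 N2).
set n := maxn N1 N2 => hn /ltW hl'.
apply: filterS (hu n) => z; rewrite -ball_normE /ball_ /= => hz.
have -> : e%:C = (e / 2)%:C + (e / 2)%:C by rewrite -rmorphD /=; congr (_%:C); field.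
have -> : l - z = (l - u n) + (u n - z) by rewrite addrA subrK.
apply: le_lt_trans (ler_normD _ _) _; apply: ler_ltD; last first.
  by apply: lt_trans hz _; rewrite ltcR.
rewrite distrC [`|_|]/(nrm _) lecR -(@ler_pXn2r _ 2) ?nnegrE ?sqrtr_ge0 ?(ltW e'0) //.
by rewrite sqr_sqrtr ?rf_ge0.
Qed.

HB.instance Definition _ := Uniform_isComplete.Build HV hilb_cauchy.

Let cip (x y : HV) : R[i] := Complex (r x y) (r x ('i *: y)).

Let cip_zl y : zmod_morphism (cip^~ y).
Proof. by move=> a b; rewrite /cip !rfDl !rfN. Qed.

Let cip_zr x : zmod_morphism (cip x).
Proof. by move=> a b; rewrite /cip scalerBr !(rfC r x) !rfDl !rfN. Qed.

Let cip_sl y : scalable_for *%R (cip^~ y).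
Proof.
move=> a x; rewrite /cip scalerCE !rfDl !rfZl rfiN rfii.
by case: a => a b /=; congr Complex; ring.
Qed.

Let cip_sr x : scalable_for (Num.conj \; *%R) (cip x).
Proof.
move=> a y; rewrite /cip /= -[Num.conj _]/(conjc _).
rewrite scalerA mulrC -scalerA !(scalerCE a) !rfDr !rfZr.
have -> : r x ('i *: ('i *: y)) = - r x y.
  by rewrite scalerA -expr2 sqr_i scaleN1r rfC rfN rfC.
by case: a => a b /=; congr Complex; ring.
Qed.

Let cip_herm x y : cip x y = (-1) ^+ false * Num.conj (cip y x).
Proof.
rewrite expr0 mul1r -[Num.conj _]/(conjc _) /cip /= (rfC r y).
by congr Complex; rewrite rfC rfiN.
Qed.

HB.instance Definition _ := isBilinear.Build R[i] HV HV R[i] *%R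
  (Num.conj \; *%R) cip cip_zl cip_zr cip_sl cip_sr.
HB.instance Definition _ := isHermitianSesquilinear.Build R[i] HV false Num.conj cip cip_herm.

Let cip_norm x : cip x x = `|x| ^+ 2.
Proof.
rewrite [`|_|]/(nrm _) /nrm /cip -rmorphXn /= sqr_sqrtr ?rf_ge0 //.
by congr Complex; have := rfiN x x; rewrite rfC; lra.
Qed.

Let cip_dot x : x != 0 -> 0 < cip x x.
Proof. by move=> x0; rewrite cip_norm exprn_gt0 // normr_gt0. Qed.

HB.instance Definition _ := isDotProduct.Build R[i] HV cip cip_dot.

HB.instance Definition _ := CompleteNormedModule_isHilbert.Build R HV cip_norm.

End HilbertOfRealIP.

Definition hilb (R : realType) (V : lmodType R[i]) (r : realIP V) :
  hilbertType R := hilb_of r.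

(** * Submodules as types *)

Record sub_of (K : pzRingType) (V : lmodType K) (S : set V)
  (hS : GRing.submod_closed [in S]) := SubOf { sub_val : V; _ : sub_val \in S }.

Section SubModule.
Variables (K : pzRingType) (V : lmodType K) (S : set V).
Hypothesis hS : GRing.submod_closed [in S].
Local Notation sub := (sub_of hS).

HB.instance Definition _ := [isSub of sub for @sub_val K V S hS].
HB.instance Definition _ := [Choice of sub by <:].
HB.instance Definition _ := GRing.SubChoice_isSubLmodule.Build K V _ sub
  (GRing.submod_closed_semi hS).

Lemma sub_valP (x : sub) : S (sub_val x).
Proof. by case: x => x Sx; exact: set_mem Sx. Qed.

Definition to_sub (x : V) (Sx : S x) : sub := SubOf hS (mem_set Sx).

Lemma sub_val_inj : injective (@sub_val K V S hS).
Proof. exact: val_inj. Qed.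

Lemma sub_valD (x y : sub) : sub_val (x + y) = sub_val x + sub_val y.
Proof. by []. Qed.

Lemma sub_valB (x y : sub) : sub_val (x - y) = sub_val x - sub_val y.
Proof. by []. Qed.

Lemma sub_valZ a (x : sub) : sub_val (a *: x) = a *: sub_val x.
Proof. by []. Qed.

End SubModule.

(** * The Hilbert space of square-summable sequences *)

Section SquareSummable.
Variables (R : realType) (G : hilbertType R).
Implicit Types u v w : nat -> G.

Definition sqsum u n : R := \sum_(i < n) nsq (u i).

Definition l2_pred : set (nat -> G) :=
  [set u | exists M : R, forall n, sqsum u n <= M].

Lemma sqsumD_le u v n : sqsum (u + v) n <= 2 * sqsum u n + 2 * sqsum v n.
Proof.
rewrite /sqsum !mulr_sumr -big_split /=.
by apply: ler_sum => i _; exact: nsqD_le.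
Qed.

Lemma l2_submod : GRing.submod_closed [in l2_pred].
Proof.
split=> [|a u v]; rewrite !inE.
  exists 0 => n; rewrite /sqsum big1 // => i _; exact/nsq_eq0.
move=> [M hM] [N hN]; pose c := complex.Re a ^+ 2 + complex.Im a ^+ 2.
exists (2 * (c * M) + 2 * N) => n.
apply: le_trans (sqsumD_le _ _ _) _; apply: lerD; last by rewrite ler_wpM2l.
rewrite ler_wpM2l //; have -> : sqsum (a *: u) n = c * sqsum u n.
  by rewrite /sqsum mulr_sumr; apply: eq_bigr => i _; exact: nsqZc.
by rewrite ler_wpM2l // addr_ge0 ?sqr_ge0.
Qed.

Definition l2_lmod : lmodType R[i] := sub_of l2_submod.
Implicit Types x y z : l2_lmod.

Definition l2_seq x : nat -> R := fun n => \sum_(i < n) nsq (sub_val x i).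

Lemma l2_seq_nd x : nondecreasing_seq (l2_seq x).
Proof.
apply/nondecreasing_seqP => n; rewrite /l2_seq big_ord_recr /=.
by rewrite lerDl nsq_ge0.
Qed.

Lemma l2_seq_cvg x : cvgn (l2_seq x).
Proof.
apply: nondecreasing_is_cvgn (l2_seq_nd x) _.
by have [M hM] := sub_valP x; exists M => _ [n _ <-]; exact: hM.
Qed.

Definition l2_part x y : nat -> R :=
  fun n => \sum_(i < n) rip (sub_val x i) (sub_val y i).

(** By polarization, the series is a combination of bounded series with
    nonnegative terms. *)
Lemma l2_part_cvg x y : cvgn (l2_part x y).
Proof.
have -> : l2_part x y = (fun n => 2^-1 * (l2_seq (x + y) n - l2_seq x n - l2_seq y n)).
  apply/funext => n; rewrite /l2_part /l2_seq -!sumrB mulr_sumr.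
  by apply: eq_bigr => i _; rewrite sub_valD nsqD; field.
apply: is_cvgMr; apply: is_cvgB; last exact: l2_seq_cvg.
by apply: is_cvgB; exact: l2_seq_cvg.
Qed.

Definition l2_rip x y : R := limn (l2_part x y).

Lemma l2_ripDl x y z : l2_rip (x + y) z = l2_rip x z + l2_rip y z.
Proof.
rewrite /l2_rip -limD; try exact: l2_part_cvg.
congr (limn _); apply/funext => n; rewrite /l2_part fctE -big_split /=.
by apply: eq_bigr => i _; exact: ripDl.
Qed.

Lemma l2_ripC x y : l2_rip x y = l2_rip y x.
Proof.
congr (limn _); apply/funext => n; apply: eq_bigr => i _; exact: ripC.
Qed.

Lemma l2_ripZl (c : R) x y : l2_rip (c%:C *: x) y = c * l2_rip x y.
Proof.
rewrite /l2_rip; apply: cvg_lim => //.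
have -> : l2_part (c%:C *: x) y = (fun n => c * l2_part x y n).
  apply/funext => n; rewrite /l2_part mulr_sumr.
  by apply: eq_bigr => i _; exact: ripZl.
by apply: cvgMr; exact: l2_part_cvg.
Qed.

Lemma l2_ripii x y : l2_rip ('i *: x) ('i *: y) = l2_rip x y.
Proof.
congr (limn _); apply/funext => n; apply: eq_bigr => i _.
by rewrite !sub_valZ ripii.
Qed.

Lemma l2_rip_ge x n : sqsum (sub_val x) n <= l2_rip x x.
Proof. exact: nondecreasing_cvgn_le (l2_seq_nd x) (@l2_seq_cvg x) n. Qed.

Lemma l2_rip_le x (M : R) : (forall n, sqsum (sub_val x) n <= M) -> l2_rip x x <= M.
Proof. by move=> h; apply: limr_le (@l2_part_cvg x x) _; near=> n; exact: h.
Unshelve. all: by end_near. Qed.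

Lemma l2_rip_ge0 x : 0 <= l2_rip x x.
Proof. by have := l2_rip_ge x 0; rewrite /sqsum big_ord0. Qed.

Lemma l2_coord_le x i : nsq (sub_val x i) <= l2_rip x x.
Proof.
apply: le_trans (l2_rip_ge x i.+1); rewrite /sqsum big_ord_recr /= lerDr.
by apply: sumr_ge0 => j _; exact: nsq_ge0.
Qed.

Lemma l2_rip_eq0 x : l2_rip x x = 0 -> x = 0.
Proof.
move=> h; apply: sub_val_inj; apply/funext => i; apply: nsq_le0.
by rewrite -h l2_coord_le.
Qed.

Lemma l2_complete (u : nat -> l2_lmod) :
  (forall e : R, 0 < e -> exists N, forall m n, (N <= m)%N -> (N <= n)%N ->
     l2_rip (u m - u n) (u m - u n) < e) ->
  exists l, forall e : R, 0 < e ->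
    exists N, forall n, (N <= n)%N -> l2_rip (u n - l) (u n - l) < e.
Proof.
move=> hu.
(* The limit l exists coordinatewise; u n - l is square-summable and small as
   its partial sums are controlled by u n - u k with k chosen large depending
   on the number of terms. *)
have ex i : exists l, nsq_cvg (fun n => sub_val (u n) i) l.
  apply: nsq_complete => e /hu[N hN]; exists N => m n Nm Nn.
  exact: le_lt_trans (l2_coord_le (u m - u n) i) (hN m n Nm Nn).
have [l hl] := choice ex.
have close p (e : R) : 0 < e -> exists N, forall n, (N <= n)%N ->
    sqsum (fun i => sub_val (u n) i - l i) p < e.
  elim: p e => [|p IH] e e0.
    by exists 0%N => n _; rewrite /sqsum big_ord0.
  have e2 : 0 < e / 2 by rewrite divr_gt0.
  have [N1 h1] := IH _ e2; have [N2 h2] := hl p _ e2.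
  exists (maxn N1 N2) => n; rewrite geq_max => /andP[n1 n2].
  rewrite /sqsum big_ord_recr /= -/(sqsum (fun i => sub_val (u n) i - l i) p).
  by have := h1 n n1; have := h2 n n2; lra.
have tail (e : R) : 0 < e -> exists N, forall n, (N <= n)%N ->
    forall p, sqsum (fun i => sub_val (u n) i - l i) p <= e.
  move=> e0; have e4 : 0 < e / 4 by rewrite divr_gt0.
  have [N hN] := hu _ e4; exists N => n Nn p.
  have [N' hN'] := close p _ e4.
  pose k := maxn N N'.
  have h1 := hN n k Nn (leq_maxl _ _); have h2 := hN' k (leq_maxr _ _).
  have h3 := sqsumD_le (sub_val (u n - u k)) (fun i => sub_val (u k) i - l i) p.
  have h4 := l2_rip_ge (u n - u k) p.
  have E : sub_val (u n - u k) + (fun i => sub_val (u k) i - l i) =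
      (fun i => sub_val (u n) i - l i).
    by apply/funext => i; rewrite sub_valB !fctE addrA subrK.
  rewrite E in h3; lra.
have [N hN] := tail 1 ltr01.
have Sd : l2_pred (fun i => sub_val (u N) i - l i) by exists 1; exact: hN.
pose d := to_sub l2_submod Sd.
have dE n i : sub_val (u n - (u N - d)) i = sub_val (u n) i - l i.
  have -> : sub_val (u n - (u N - d)) i =
    sub_val (u n) i - (sub_val (u N) i - (sub_val (u N) i - l i)) by [].
  by rewrite subKr.
exists (u N - d) => e e0; have e2 : 0 < e / 2 by rewrite divr_gt0.
have [N1 hN1] := tail _ e2; exists N1 => n Nn.
apply: (@le_lt_trans _ _ (e / 2)); last by lra.
apply: l2_rip_le => p; have -> : sqsum (sub_val (u n - (u N - d))) p =
    sqsum (fun i => sub_val (u n) i - l i) p.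
  by apply: eq_bigr => i _; rewrite dE.
exact: hN1.
Qed.

Definition l2_form : realIP l2_lmod :=
  RealIP l2_ripDl l2_ripC l2_ripZl l2_ripii l2_rip_ge0 l2_rip_eq0 l2_complete.

End SquareSummable.

(** All that is used of square-summable sequences. The instance [l2_space] is
    opaque, because comparing two vectors must never unfold the construction of
    the inner product as a limit. *)
Record sequence_space (R : realType) (G : hilbertType R) := SequenceSpace {
  l2_carrier : hilbertType R;
  l2_coord : l2_carrier -> nat -> G;
  l2_make : forall u : nat -> G, l2_pred u -> l2_carrier;
  l2_coord_inj : injective l2_coord;
  l2_coord_lin : forall a x y i,
    l2_coord (a *: x + y) i = a *: l2_coord x i + l2_coord y i;
  l2_coord_make : forall u (hu : l2_pred u), l2_coord (l2_make hu) = u;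
  l2_sqsum_le_nsq : forall x n, sqsum (l2_coord x) n <= nsq x;
  l2_nsq_le : forall x (M : R), (forall n, sqsum (l2_coord x) n <= M) -> nsq x <= M
}.

Definition l2_space (R : realType) (G : hilbertType R) : sequence_space G.
Proof.
apply: (@SequenceSpace R G (hilb (l2_form G))
  (fun x => sub_val (x : l2_lmod G)) (fun u hu => to_sub (l2_submod G) hu)).
- exact: sub_val_inj.
- by [].
- by [].
- exact: l2_rip_ge.
- exact: l2_rip_le.
Qed.

Section L2Maps.
Variables (R : realType) (G : hilbertType R).

Definition l2 : hilbertType R := l2_carrier (l2_space G).

Definition seq_of (x : l2) : nat -> G := l2_coord x.

Definition of_seq (u : nat -> G) (hu : l2_pred u) : l2 := l2_make (l2_space G) hu.

Lemma seq_of_inj : injective seq_of.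
Proof. exact: l2_coord_inj. Qed.

Lemma seq_of_lin a (x y : l2) i :
  seq_of (a *: x + y) i = a *: seq_of x i + seq_of y i.
Proof. exact: l2_coord_lin. Qed.

Lemma of_seqK (u : nat -> G) (hu : l2_pred u) : seq_of (of_seq hu) = u.
Proof. exact: l2_coord_make. Qed.

Lemma sqsum_nsq (x : l2) n : sqsum (seq_of x) n <= nsq x.
Proof. exact: l2_sqsum_le_nsq. Qed.

Lemma nsq_l2_le (x : l2) (M : R) :
  (forall n, sqsum (seq_of x) n <= M) -> nsq x <= M.
Proof. exact: l2_nsq_le. Qed.

Lemma column_map (H : hilbertType R) (Y : nat -> H -> G) (M : R) :
  (forall i, linear (Y i)) ->
  (forall h n, sqsum (fun i => Y i h) n <= M * nsq h) ->
  exists2 W : H -> l2, bop W & forall h i, seq_of (W h) i = Y i h.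
Proof.
move=> lY hM.
have S h : l2_pred (fun i => Y i h) by exists (M * nsq h); exact: hM.
pose W h : l2 := of_seq (S h).
have WE h i : seq_of (W h) i = Y i h by rewrite of_seqK.
exists W => //; apply: (@bopI _ _ _ _ M) => [a x y|x]; last first.
  by apply: nsq_l2_le => n; rewrite of_seqK; exact: hM.
by apply: seq_of_inj; apply/funext => i; rewrite seq_of_lin !WE; exact: lY.
Qed.

Lemma l2_embed : exists2 i0 : G -> l2, linear i0 & forall g, nsq (i0 g) = nsq g.
Proof.
have E (g : G) n : sqsum (fun i => if i == 0%N then g else 0) n =
    if n == 0%N then 0 else nsq g.
  case: n => [|n]; rewrite /sqsum ?big_ord0 // big_ord_recl /= big1 ?addr0 //.
  by move=> i _; exact/nsq_eq0.
have [||W hW WE] := @column_map G (fun i g => if i == 0%N then g else 0) 1.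
- by move=> i a x y; case: eqP => // _; rewrite scaler0 addr0.
- by move=> g n; rewrite E mul1r; case: ifP => // _; exact: nsq_ge0.
have sE g : seq_of (W g) = (fun i => if i == 0%N then g else 0).
  by apply/funext => i; exact: WE.
exists W => [|g]; first exact: hW.1.
apply/eqP; rewrite eq_le; apply/andP; split; last first.
  by have := sqsum_nsq (W g) 1; rewrite sE E.
apply: nsq_l2_le => n; rewrite sE E; case: ifP => // _; exact: nsq_ge0.
Qed.

Definition interleave (u v : nat -> G) n := if odd n then v n./2 else u n./2.

Lemma sqsum_interleave u v n :
  sqsum (interleave u v) n.*2 = sqsum u n + sqsum v n.
Proof.
elim: n => [|n IH]; first by rewrite /sqsum !big_ord0 addr0.
rewrite doubleS /sqsum !big_ord_recr /= -!/(sqsum _ _) IH /interleave /=.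
by rewrite odd_double /= doubleK uphalf_double; ring.
Qed.

Lemma sqsum_mono (u : nat -> G) m n : (m <= n)%N -> sqsum u m <= sqsum u n.
Proof.
move=> /subnKC <-; elim: (n - m)%N => [|k IH]; first by rewrite addn0.
rewrite addnS /sqsum big_ord_recr /=; apply: le_trans IH _.
by rewrite lerDl nsq_ge0.
Qed.

End L2Maps.

(** A pair of isometries [J0], [J1] identifying the orthogonal sum of two copies
    of [L] with [L] itself. Thanks to such a pair every dilation below can be
    performed without leaving the space [L]. *)
Record splitting (R : realType) (L : hilbertType R) := Splitting {
  J0 : L -> L;
  J1 : L -> L;
  J0_lin : linear J0;
  J1_lin : linear J1;
  J_nsq : forall u v, nsq (J0 u + J1 v) = nsq u + nsq v;
  J_surj : forall w, exists u v, w = J0 u + J1 v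
}.

(** The two halves are the sequences supported on the even and on the odd
    indices. *)
Lemma l2_splitting (R : realType) (G : hilbertType R) :
  exists s : splitting (l2 G), True.
Proof.
have Sm (u v : l2 G) : l2_pred (interleave (seq_of u) (seq_of v)).
  exists (nsq u + nsq v) => n; apply: le_trans (sqsum_mono _ (leq_addl n n)) _.
  by rewrite addnn sqsum_interleave lerD ?sqsum_nsq.
pose mix u v : l2 G := of_seq (Sm u v).
have mixS u v : seq_of (mix u v) = interleave (seq_of u) (seq_of v).
  exact: of_seqK.
have mix_nsq u v : nsq (mix u v) = nsq u + nsq v.
  apply/eqP; rewrite eq_le; apply/andP; split.
    apply: nsq_l2_le => n; apply: le_trans (sqsum_mono _ (leq_addl n n)) _.
    by rewrite addnn mixS sqsum_interleave lerD ?sqsum_nsq.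
  have h m n : sqsum (seq_of u) m + sqsum (seq_of v) n <= nsq (mix u v).
    apply: le_trans (sqsum_nsq (mix u v) (maxn m n).*2); rewrite mixS sqsum_interleave.
    by rewrite lerD ?sqsum_mono ?leq_maxl ?leq_maxr.
  rewrite -lerBrDr; apply: nsq_l2_le => m; rewrite lerBrDr -lerBrDl.
  by apply: nsq_l2_le => n; rewrite lerBrDl.
have mix_lin a u v u' v' :
    mix (a *: u + u') (a *: v + v') = a *: mix u v + mix u' v'.
  apply: seq_of_inj; apply/funext => i; rewrite seq_of_lin !mixS /interleave.
  by case: ifP; rewrite seq_of_lin.
have mixD u v : mix u 0 + mix 0 v = mix u v.
  by have := mix_lin 1 u 0 0 v; rewrite !scale1r !(addr0, add0r) => ->.
have lin0l : linear (mix^~ 0).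
  by move=> a u v /=; rewrite -mix_lin scaler0 addr0.
have lin0r : linear (mix 0).
  by move=> a u v; rewrite -mix_lin scaler0 addr0.
suff surj w : exists u v, w = mix u 0 + mix 0 v.
  by exists (Splitting lin0l lin0r (fun u v => etrans (congr1 _ (mixD u v)) (mix_nsq u v)) surj).
have wE : interleave (fun n => seq_of w n.*2) (fun n => seq_of w n.*2.+1) = seq_of w.
  apply/funext => i; rewrite /interleave.
  by case: ifP => oi; rewrite -[in RHS](odd_double_half i) oi.
have sum_ge0 (f : nat -> G) n : 0 <= sqsum f n.
  by apply: sumr_ge0 => i _; exact: nsq_ge0.
have Sev : l2_pred (fun n => seq_of w n.*2).
  exists (nsq w) => n; apply: le_trans (sqsum_nsq w n.*2).
  by rewrite -[in leRHS]wE sqsum_interleave lerDl.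
have Sod : l2_pred (fun n => seq_of w n.*2.+1).
  exists (nsq w) => n; apply: le_trans (sqsum_nsq w n.*2).
  by rewrite -[in leRHS]wE sqsum_interleave lerDr.
exists (of_seq Sev), (of_seq Sod).
by rewrite mixD; apply: seq_of_inj; rewrite mixS !of_seqK wE.
Qed.

(** * Polarization and limits *)

Section Polarization.
Variable R : realType.
Implicit Types H K L : hilbertType R.

Lemma rip_nsq H (x y : H) : rip x y = (nsq (x + y) - nsq x - nsq y) / 2.
Proof. by rewrite nsqD; field. Qed.

Lemma isometry_rip H K (f : H -> K) : linear f -> (forall x, nsq (f x) = nsq x) ->
  forall x y, rip (f x) (f y) = rip x y.
Proof. by move=> lf h x y; rewrite !rip_nsq -(linD lf) !h. Qed.

Lemma nsq_cvgP H (u : nat -> H) l :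
  nsq_cvg u l <-> nsq (u n - l) @[n --> \oo] --> (0 : R).
Proof.
split=> [h|/cvgrPdist_lt h e e0].
  apply/cvgrPdist_lt => e e0; have [N hN] := h e e0.
  exists N => // n /= Nn; rewrite sub0r normrN ger0_norm ?nsq_ge0 //; exact: hN.
have [N _ hN] := h e e0; exists N => n Nn.
by have := hN n Nn; rewrite /= sub0r normrN ger0_norm ?nsq_ge0.
Qed.

Lemma nsq_cvg_lin H (a : R[i]) (u v : nat -> H) l m :
  nsq_cvg u l -> nsq_cvg v m -> nsq_cvg (fun n => a *: u n + v n) (a *: l + m).
Proof.
move=> /nsq_cvgP hu /nsq_cvgP hv; apply/nsq_cvgP.
pose c := complex.Re a ^+ 2 + complex.Im a ^+ 2.
apply: (@squeeze_cvgr _ _ _ _ (cst 0) (fun n => 2 * (c * nsq (u n - l)) + 2 * nsq (v n - m))).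
- near=> n; rewrite nsq_ge0 /=.
  have -> : a *: u n + v n - (a *: l + m) = a *: (u n - l) + (v n - m).
    by rewrite scalerBr opprD addrACA.
  by apply: le_trans (nsqD_le _ _) _; rewrite nsqZc.
- exact: cvg_cst.
- have -> : 0 = 2 * (c * 0) + 2 * 0 :> R by rewrite !mulr0 addr0.
  by apply: cvgD; apply: cvgMr => //; apply: cvgMr.
Unshelve. all: by end_near. Qed.

Lemma cvg_rip0 H (u : nat -> H) l w : nsq_cvg u l -> (forall n, rip (u n) w = 0) ->
  rip l w = 0.
Proof.
move=> hu h; apply: (@eq0_small _ _ (nsq w)) (nsq_ge0 _) _ => e e0.
have [N hN] := hu e e0; have := rip_CS (u N - l) w.
rewrite ripBl h sub0r sqrrN => /le_trans; apply.
by rewrite ler_wpM2r ?nsq_ge0 // ltW // hN.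
Qed.

Lemma cvg_nsq H (u : nat -> H) l : nsq_cvg u l -> nsq (u n) @[n --> \oo] --> nsq l.
Proof.
move=> hu; apply/cvgrPdist_lt => e e0.
pose d := Num.min (e / 2) (e ^+ 2 / (16 * (nsq l + 1))).
have l0 := nsq_ge0 l.
have d0 : 0 < d by rewrite lt_min divr_gt0 //= divr_gt0 ?exprn_gt0 //; lra.
have [N hN] := hu d d0; exists N => // n /= /hN; rewrite lt_min => /andP[h1 h2].
have cs := rip_CS (u n - l) l.
have -> : nsq l - nsq (u n) = - (nsq (u n - l) + 2 * rip (u n - l) l).
  by rewrite nsqB ripBl -[rip l l]/(nsq l); ring.
rewrite normrN; apply: le_lt_trans (ler_normD _ _) _.
rewrite (ger0_norm (nsq_ge0 _)) normrM ger0_norm //.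
suff : `|rip (u n - l) l| <= e / 4 by lra.
rewrite -(@ler_pXn2r _ 2) ?nnegrE //; last by lra.
rewrite real_normK ?num_real //; apply: le_trans cs _.
apply: (@le_trans _ _ (e ^+ 2 / (16 * (nsq l + 1)) * nsq l)).
  by rewrite ler_wpM2r // ltW.
rewrite mulrAC ler_pdivrMr; last by lra.
have := sqr_ge0 e; nra.
Qed.

End Polarization.

(** * Positive operators *)

Section Positive.
Variable R : realType.
Implicit Types H K L : hilbertType R.

Definition posop H (A : H -> H) :=
  [/\ bop A, forall x, 0 <= rip (A x) x & forall x y, rip (A x) y = rip x (A y)].

(** A complex operator with real quadratic form is symmetric. Polarization makes
    [(x, y) |-> rip (A x) (i y)] alternating, which is symmetry after replacing
    [y] by [- i y]. *)
Lemma symmetric_of_real H (A : H -> H) : linear A ->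
  (forall x, complex.Im '[A x, x] = 0) -> forall x y, rip (A x) y = rip x (A y).
Proof.
move=> lA h.
have hi x : rip (A x) ('i *: x) = 0 by have := h x; rewrite ipE.
have anti x y : rip (A x) ('i *: y) = - rip (A y) ('i *: x).
  have := hi (x + y); rewrite (linD lA) scalerDr ripDl !ripDr !hi; lra.
move=> x y; have {1}-> : y = 'i *: (- ('i *: y)).
  by rewrite scalerN scalerA -expr2 sqr_i scaleN1r opprK.
rewrite anti (linN lA) (linZ lA) ripNl opprK ripii ripC //.
Qed.

Lemma posop_CS H (A : H -> H) x y : posop A ->
  rip (A x) y ^+ 2 <= rip (A x) x * rip (A y) y.
Proof.
move=> [[lA _] A0 As]; apply: quadratic_discr (A0 _) _ => t.
have := A0 (x + t%:C *: y).
rewrite (linD lA) (linZ lA) ripDl !ripDr !ripZl !ripZr (As y x) (ripC y); lra.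
Qed.

Lemma posop_sq_le H (A : H -> H) (c : R) : posop A ->
  (forall x, rip (A x) x <= c * nsq x) ->
  forall x, nsq (A x) <= c * rip (A x) x.
Proof.
move=> pA hc x; have [_ A0 _] := pA.
have [n0|n0] := eqVneq (nsq (A x)) 0.
  move/nsq_eq0: (n0) => ->; rewrite /nsq !rip0l; lra.
have np : 0 < nsq (A x) by rewrite lt_def n0 nsq_ge0.
rewrite -(@ler_pM2r _ (nsq (A x))) //.
apply: le_trans (posop_CS x (A x) pA) _.
by rewrite mulrAC mulrC ler_wpM2r // hc.
Qed.

(** For [0 <= A <= 1] put [A_0 = A] and [A_(n+1) = A_n - A_n^2]. These operators
    stay between [0] and [A], and [A = A_0^2 + ... + A_(n-1)^2 + A_n] forces
    [A_n h] to tend to [0]; hence [A = Z^* Z] where [Z h] is the sequence of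
    the [A_n h], a map which takes the place of a square root of [A]. *)
Lemma factor_unit H (A : H -> H) : posop A -> (forall x, rip (A x) x <= nsq x) ->
  exists2 Z : H -> l2 H, bop Z & forall x, nsq (Z x) = rip (A x) x.
Proof.
move=> pA A1.
pose B := fix B n : H -> H := if n is m.+1 then fun x => B m x - B m (B m x) else A.
have hB n : posop (B n) /\ forall x, rip (B n x) x <= nsq x.
  elim: n => [|n [pB B1]] //=.
  have B1' x : rip (B n x) x <= 1 * nsq x by rewrite mul1r.
  have sq x : nsq (B n x) <= rip (B n x) x.
    by have := posop_sq_le pB B1' x; rewrite mul1r.
  have [bB B0 Bs] := pB.
  have qE x : rip (B n x - B n (B n x)) x = rip (B n x) x - nsq (B n x).
    by rewrite ripBl (Bs (B n x)).
  split=> [|x]; last by rewrite qE; have := nsq_ge0 (B n x); have := B1 x; lra.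
  split=> [|x|x y]; last by rewrite ripBl ripBr (Bs (B n x)) !Bs.
  - exact: bopB (bop_comp bB bB).
  - by rewrite qE subr_ge0.
have sumE x n : \sum_(i < n) nsq (B i x) = rip (A x) x - rip (B n x) x.
  elim: n => [|n IH]; first by rewrite big_ord0 subrr.
  rewrite big_ord_recr /= IH ripBl.
  by have [[_ _ Bs] _] := hB n; rewrite (Bs (B n x)) -/(nsq _); ring.
have sum_le x n : \sum_(i < n) nsq (B i x) <= rip (A x) x.
  by rewrite sumE; have [[_ B0 _] _] := hB n; have := B0 x; lra.
have [||Z bZ ZE] := @column_map R H H B 1.
- by move=> n; have [[[]]] := hB n.
- by move=> x n; apply: le_trans (sum_le x n) _; rewrite mul1r.
exists Z => // x; have seqE : seq_of (Z x) = B^~ x by apply/funext => i; rewrite ZE.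
apply/eqP; rewrite eq_sym -subr_eq0; apply/eqP.
have lb : nsq (Z x) <= rip (A x) x.
  by apply: nsq_l2_le => n; rewrite seqE; exact: sum_le.
apply: (@eq0_small _ _ (nsq x)) (nsq_ge0 _) _ => e e0.
(* Otherwise the partial sums would exceed any bound. *)
have [n hn] : exists n, nsq (B n x) <= e.
  apply: contrapT => /forallNP nle.
  have ge n : n%:R * e <= rip (A x) x.
    apply: le_trans (sum_le x n); rewrite mulr_natl -[n in e *+ n]card_ord -sumr_const.
    by apply: ler_sum => i _; have /negP := nle i; rewrite -ltNge => /ltW.
  have := ge (Num.truncn (rip (A x) x / e)).+1.
  rewrite -ler_pdivlMr // leNgt => /negP; apply; exact: truncnS_gt.
have le1 : rip (A x) x - nsq (Z x) <= rip (B n x) x.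
  by have := sqsum_nsq (Z x) n; rewrite seqE /sqsum sumE; lra.
apply: (@le_trans _ _ (rip (B n x) x ^+ 2)).
  by rewrite ler_pXn2r // nnegrE ?subr_ge0 //; lra.
by apply: le_trans (rip_CS _ _) _; rewrite ler_wpM2r ?nsq_ge0.
Qed.

(** Rescaling reduces the general case to [A <= 1]. *)
Lemma factor H (A : H -> H) : posop A ->
  exists2 Z : H -> l2 H, bop Z & forall x, nsq (Z x) = rip (A x) x.
Proof.
move=> pA; have [[lA [M hM]] A0 As] := pA.
pose c := (`|M| + 1) / 2.
have c0 : 0 < c by rewrite divr_gt0 // ltr_wpDl.
have Ac x : rip (A x) x <= c * nsq x.
  have := nsq_ge0 (A x - x); rewrite nsqB.
  have : nsq (A x) <= `|M| * nsq x.
    by apply: le_trans (hM x) _; rewrite ler_wpM2r ?nsq_ge0 ?ler_norm.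
  by rewrite /c; lra.
have bA : bop A by split=> //; exists M.
have [||Z bZ ZE] := @factor_unit H (fun x => (c^-1)%:C *: A x).
- split; first exact: bopZ.
    by move=> x; rewrite ripZl mulr_ge0 // invr_ge0 ltW.
  by move=> x y; rewrite ripZl ripZr As.
- by move=> x; rewrite ripZl mulrC ler_pdivrMr // mulrC.
exists (fun x => (Num.sqrt c)%:C *: Z x); first exact: bopZ.
by move=> x; rewrite nsqZ ZE sqr_sqrtr ?ltW // ripZl mulrA divff ?gt_eqF // mul1r.
Qed.

End Positive.

(** * Factorization of contractive and isometric correspondences *)

Section Douglas.
Variable R : realType.
Implicit Types H K L : hilbertType R.

(** If [||Y h|| <= ||Z h||] then [Z h |-> Y h] extends by continuity to the
    closure of the range of [Z] and by [0] to its orthogonal complement; [P] is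
    the projection onto that complement. *)
Lemma douglas H L K (Z : H -> L) (Y : H -> K) : bop Z -> bop Y ->
  (forall h, nsq (Y h) <= nsq (Z h)) ->
  exists (C : L -> K) (P : L -> L), [/\ bop C, bop P, forall h, C (Z h) = Y h, forall h, P (Z h) = 0 &
    (forall g, nsq (C g) + nsq (P g) <= nsq g) /\
    ((forall h, nsq (Y h) = nsq (Z h)) ->
      forall g, nsq (C g) + nsq (P g) = nsq g)].
Proof.
move=> bZ bY YZ; have [lZ _] := bZ; have [lY _] := bY.
(* Rel g p y holds when p is the projection of g onto the closure of the range
   of Z and y is the value at p of the continuous extension of Z h |-> Y h. *)
pose Rel g p y := (forall v, rip (Z v) (g - p) = 0) /\
  exists v, nsq_cvg (Z \o v) p /\ nsq_cvg (Y \o v) y.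
have ex g : exists py, Rel g py.1 py.2.
  have [||c v|v|p [hp ap]] := @riesz_range R H L Z (fun v => rip (Z v) g) (nsq g).
  - exact: lZ.
  - by move=> u v; rewrite (linD lZ) ripDl.
  - by rewrite (linZ lZ) ripZl.
  - by rewrite mulrC rip_CS.
  have exv (n : nat) : exists v, nsq (Z v - p) < n.+1%:R^-1.
    by apply: ap; rewrite invr_gt0.
  have [v hv] := choice exv.
  have cZ : nsq_cvg (Z \o v) p.
    move=> e /small_inv[N hN]; exists N => n Nn.
    exact: lt_trans (hv n) (hN n Nn).
  have [|y cY] := @nsq_complete R K (Y \o v).
    move=> e e0; have e4 : 0 < e / 4 by rewrite divr_gt0.
    have [N hN] := cZ _ e4; exists N => m n Nm Nn /=.
    rewrite -(linB lY); apply: le_lt_trans (YZ _) _; rewrite (linB lZ).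
    have -> : Z (v m) - Z (v n) = (Z (v m) - p) + - (Z (v n) - p).
      by rewrite opprB addrA subrK.
    apply: le_lt_trans (nsqD_le _ _) _; rewrite nsqN.
    have := hN m Nm; have := hN n Nn; rewrite /=; lra.
  exists (p, y); split; last by exists v.
  by move=> w; rewrite ripBr hp subrr.
have RelL a g p y g' p' y' : Rel g p y -> Rel g' p' y' ->
    Rel (a *: g + g') (a *: p + p') (a *: y + y').
  move=> [h1 [v [c1 c2]]] [h1' [v' [c1' c2']]]; split.
    move=> w; have -> : a *: g + g' - (a *: p + p') = a *: (g - p) + (g' - p').
      by rewrite scalerBr opprD addrACA.
    rewrite ripDr h1' addr0 [a]complexE scalerDl ripDr ripZr h1 mulr0 add0r.
    rewrite mulrC -scalerA ripZr -[rip _ ('i *: _)]opprK -ripil -(linZ lZ) h1.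
    by rewrite oppr0 mulr0.
  exists (fun n => a *: v n + v' n); split.
    have -> : Z \o (fun n => a *: v n + v' n) =
        (fun n => a *: (Z \o v) n + (Z \o v') n) by apply/funext => n /=; exact: lZ.
    exact: nsq_cvg_lin.
  have -> : Y \o (fun n => a *: v n + v' n) =
      (fun n => a *: (Y \o v) n + (Y \o v') n) by apply/funext => n /=; exact: lY.
  exact: nsq_cvg_lin.
have nsq_le p y v : nsq_cvg (Z \o v) p -> nsq_cvg (Y \o v) y -> nsq y <= nsq p.
  move=> /cvg_nsq c1 /cvg_nsq c2; apply: ler_cvg_to c2 c1 _.
  by near=> n; exact: YZ.
have orth g p y : Rel g p y -> nsq g = nsq p + nsq (g - p).
  move=> [h1 [v [c1 _]]]; have e0 : rip p (g - p) = 0.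
    by apply: cvg_rip0 c1 _ => n; exact: h1.
  by have := nsqD p (g - p); rewrite addrC subrK e0; lra.
have uniq p y : Rel 0 p y -> p = 0 /\ y = 0.
  move=> r; have := orth _ _ _ r; have [_ [v [c1 c2]]] := r.
  rewrite sub0r nsqN {1}/nsq rip0l => /esym e0.
  have p0 : p = 0 by apply: nsq_le0; have := nsq_ge0 p; lra.
  split=> //; apply: nsq_le0; have := nsq_le _ _ _ c1 c2.
  by rewrite p0 {2}/nsq rip0l.
have [f hf] := choice ex.
have feq g p y : Rel g p y -> f g = (p, y).
  move=> r; have := RelL (-1) _ _ _ _ _ _ r (hf g).
  rewrite !scaleN1r addNr => /uniq[/eqP e1 /eqP e2].
  rewrite addr_eq0 eqr_opp in e1; rewrite addr_eq0 eqr_opp in e2.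
  by rewrite (eqP e1) (eqP e2); exact: surjective_pairing.
have fL a g g' : f (a *: g + g') = (a *: (f g).1 + (f g').1, a *: (f g).2 + (f g').2).
  exact/feq/RelL.
have fZ h : f (Z h) = (Z h, Y h).
  apply: feq; split=> [v|]; first by rewrite subrr rip0r.
  have cc (W : hilbertType R) (w : W) : nsq_cvg (fun _ : nat => w) w.
    by move=> e e0; exists 0%N => n _; rewrite subrr /nsq rip0l.
  by exists (fun=> h); split; exact: cc.
have bound g : nsq (f g).2 + nsq (g - (f g).1) <= nsq g.
  have [_ [v [c1 c2]]] := hf g; rewrite (orth _ _ _ (hf g)) lerD2r.
  exact: nsq_le c1 c2.
exists (fun g => (f g).2), (fun g => g - (f g).1); split=> //.
- apply: (@bopI _ _ _ _ 1) => [a x y|x]; first by rewrite fL.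
  by have := bound x; have := nsq_ge0 (x - (f x).1); lra.
- apply: (@bopI _ _ _ _ 1) => [a x y|x].
    by rewrite fL /= scalerBr opprD addrACA.
  by have := bound x; have := nsq_ge0 (f x).2; lra.
- by move=> h; rewrite fZ.
- by move=> h; rewrite fZ subrr.
split=> // YZe g; have [_ [v [c1 c2]]] := hf g.
rewrite [RHS](orth _ _ _ (hf g)); congr (_ + _).
apply: cvg_unique (cvg_nsq c2) _ => //.
have -> : (fun n => nsq ((Y \o v) n)) = (fun n => nsq ((Z \o v) n)).
  by apply/funext => n; exact: YZe.
exact: cvg_nsq.
Unshelve. all: by end_near. Qed.

End Douglas.

Section Splitting.
Variables (R : realType) (L : hilbertType R) (s : splitting L).
Local Notation J0 := (J0 s).
Local Notation J1 := (J1 s).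

Lemma J00 : J0 0 = 0. Proof. exact: lin0 (J0_lin s). Qed.
Lemma J10 : J1 0 = 0. Proof. exact: lin0 (J1_lin s). Qed.

Lemma J0_nsq u : nsq (J0 u) = nsq u.
Proof. by have := J_nsq s u 0; rewrite J10 !addr0 /nsq rip0l addr0. Qed.

Lemma J1_nsq u : nsq (J1 u) = nsq u.
Proof. by have := J_nsq s 0 u; rewrite J00 !add0r /nsq rip0l add0r. Qed.

Lemma bop_J0 : bop J0. Proof. exact: bop_isometry (J0_lin s) J0_nsq. Qed.
Lemma bop_J1 : bop J1. Proof. exact: bop_isometry (J1_lin s) J1_nsq. Qed.

Lemma J_rip u v u' v' : rip (J0 u + J1 v) (J0 u' + J1 v') = rip u u' + rip v v'.
Proof.
rewrite !rip_nsq addrACA -(linD (J0_lin s)) -(linD (J1_lin s)) !J_nsq.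
by field.
Qed.

Lemma J01_rip u v : rip (J0 u) (J1 v) = 0.
Proof. by have := J_rip u 0 0 v; rewrite J00 J10 addr0 add0r rip0r rip0l addr0. Qed.

Definition P0 := adj J0.
Definition P1 := adj J1.

Lemma bop_P0 : bop P0. Proof. exact: bop_adj bop_J0. Qed.
Lemma bop_P1 : bop P1. Proof. exact: bop_adj bop_J1. Qed.

Lemma P0E u v : P0 (J0 u + J1 v) = u.
Proof.
apply: adj_eq bop_J0 _ => x.
by have := J_rip x 0 u v; rewrite J10 addr0 rip0l addr0.
Qed.

Lemma P1E u v : P1 (J0 u + J1 v) = v.
Proof.
apply: adj_eq bop_J1 _ => x.
by have := J_rip 0 x u v; rewrite J00 add0r rip0l add0r.
Qed.

Lemma P0J0 u : P0 (J0 u) = u. Proof. by have := P0E u 0; rewrite J10 addr0. Qed.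
Lemma P1J0 u : P1 (J0 u) = 0. Proof. by have := P1E u 0; rewrite J10 addr0. Qed.
Lemma J_decomp w : J0 (P0 w) + J1 (P1 w) = w.
Proof. by have [u [v ->]] := J_surj s w; rewrite P0E P1E. Qed.

Lemma nsq_decomp w : nsq w = nsq (P0 w) + nsq (P1 w).
Proof. by rewrite -{1}(J_decomp w) J_nsq. Qed.

(** An isometric correspondence [Z h |-> Y h] may have no isometric extension
    inside [L], but it has one after [Y] is moved to the first half of [L]: the
    complement of the range of [Z] goes to the second half. Only a half of the
    second half is used, which leaves room for further isometries. *)
Lemma isometry_extension (H : hilbertType R) (Z Y : H -> L) : bop Z -> bop Y ->
  (forall h, nsq (Y h) = nsq (Z h)) ->
  exists Psi : L -> L, [/\ bop Psi, forall h, Psi (Z h) = J0 (Y h) &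
    forall g x, nsq (Psi g + J1 (J1 x)) = nsq g + nsq x].
Proof.
move=> bZ bY YZ.
have [|C [P [bC bP CZ PZ [_ hCP]]]] := douglas bZ bY.
  by move=> h; rewrite YZ.
exists (fun g => J0 (C g) + J1 (J0 (P g))); split=> [|h|g x].
- apply: bopD; first exact: bop_comp bop_J0 bC.
  by apply: bop_comp bop_J1 _; apply: bop_comp bop_J0 bP.
- by rewrite CZ PZ J00 J10 addr0.
- by rewrite -addrA -(linD (J1_lin s)) !J_nsq addrA hCP.
Qed.

End Splitting.

(** * Invariant majorants *)

Section PosopAlgebra.
Variable R : realType.
Implicit Types H K L : hilbertType R.

Lemma posopI H (A : H -> H) : bop A -> (forall x y, rip (A x) y = rip x (A y)) ->
  (forall x, 0 <= rip (A x) x) -> posop A.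
Proof. by []. Qed.

Lemma gram_rip H K (W : H -> K) x : bop W -> rip (adj W (W x)) x = nsq (W x).
Proof. by move=> bW; rewrite rip_adj. Qed.

Lemma posop_gram H K (W : H -> K) : bop W -> posop (fun x => adj W (W x)).
Proof.
move=> bW; apply: posopI => [|x y|x]; first exact: bop_comp (bop_adj bW) bW.
  by rewrite rip_adj // adj_rip.
by rewrite gram_rip // nsq_ge0.
Qed.

Lemma posopD H (A B : H -> H) : posop A -> posop B -> posop (fun x => A x + B x).
Proof.
move=> [bA A0 As] [bB B0 Bs]; apply: posopI => [|x y|x]; first exact: bopD.
  by rewrite ripDl ripDr As Bs.
by rewrite ripDl addr_ge0.
Qed.

Lemma posopZ H (c : R) (A : H -> H) : 0 <= c -> posop A -> posop (fun x => c%:C *: A x).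
Proof.
move=> c0 [bA A0 As]; apply: posopI => [|x y|x]; first exact: bopZ.
  by rewrite ripZl ripZr As.
by rewrite ripZl mulr_ge0.
Qed.

Lemma posop_id H : posop (fun x : H => x).
Proof. by apply: posopI => [|//|x]; [exact: bop_id | exact: nsq_ge0]. Qed.

Lemma posop_conj H (T A : H -> H) : bop T -> posop A ->
  posop (fun x => adj T (A (T x))).
Proof.
move=> bT [bA A0 As]; apply: posopI => [|x y|x].
- exact: bop_comp (bop_adj bT) (bop_comp bA bT).
- by rewrite rip_adj // As -adj_rip.
- by rewrite rip_adj.
Qed.

Lemma posopB H (A B : H -> H) : posop A -> posop B ->
  (forall x, rip (B x) x <= rip (A x) x) -> posop (fun x => A x - B x).
Proof.
move=> [bA A0 As] [bB B0 Bs] BA; apply: posopI => [|x y|x]; first exact: bopB.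
  by rewrite ripBl ripBr As Bs.
by rewrite ripBl subr_ge0.
Qed.

Lemma nsq_l2_shift L (w w' : l2 L) :
  (forall k, seq_of w k.+1 = seq_of w' k) -> nsq w = nsq (seq_of w 0) + nsq w'.
Proof.
move=> h.
have E n : sqsum (seq_of w) n.+1 = nsq (seq_of w 0) + sqsum (seq_of w') n.
  by rewrite /sqsum big_ord_recl; congr (_ + _); apply: eq_bigr => i _; rewrite -h.
apply/eqP; rewrite eq_le; apply/andP; split.
  apply: nsq_l2_le => n; apply: le_trans (sqsum_mono _ (leqnSn n)) _.
  by rewrite E lerD2l sqsum_nsq.
rewrite -lerBrDl; apply: nsq_l2_le => n; rewrite lerBrDl -E; exact: sqsum_nsq.
Qed.

(** The key step: a [T]-superinvariant [A] between [0] and [c] lies below a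
    [T]-invariant one, provided [T] is expansive. The defect [Q = A - T^*AT] has
    to be compensated by some [Rr >= 0] with [T^* Rr T - Rr = Q] and
    [Rr <= D := c - A]. With [D = d^*d] and [Q = q^*q], expansivity reads
    [||d h||^2 + ||q h||^2 <= ||d T h||^2], so that [d h = G1 d T h] and
    [q h = G2 d T h] for a column contraction [(G1, G2)]. The solution is
    [<Rr h, h> = sum_k ||G2 G1^k d h||^2], which telescopes to at most
    [||d h||^2]. *)
Lemma invariant_majorant H (T A : H -> H) (c : R) : bop T -> posop A ->
  (forall x, nsq x <= nsq (T x)) ->
  (forall x, rip (A (T x)) (T x) <= rip (A x) x) ->
  (forall x, rip (A x) x <= c * nsq x) ->
  exists B : H -> H, [/\ posop B,
    forall x, rip (B (T x)) (T x) = rip (B x) x,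
    forall x, rip (A x) x <= rip (B x) x &
    forall x, rip (B x) x <= c * nsq x].
Proof.
move=> bT pA expT contrA Ac; have [bA A0 As] := pA.
have pD : posop (fun x => c%:C *: x - A x).
  apply: posopI => [|x y|x]; first exact: bopB (bopZ _ (bop_id _)) bA.
    by rewrite ripBl ripBr ripZl ripZr As.
  by rewrite ripBl ripZl subr_ge0.
have pQ : posop (fun x => A x - adj T (A (T x))).
  by apply: posopB pA (posop_conj bT pA) _ => x; rewrite rip_adj.
have [d bd dE] := factor pD; have [q bq qE] := factor pQ.
have {}dE x : nsq (d x) = c * nsq x - rip (A x) x by rewrite dE ripBl ripZl.
have {}qE x : nsq (q x) = rip (A x) x - rip (A (T x)) (T x).
  by rewrite qE ripBl rip_adj.
have [s _] := l2_splitting H.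
have c0 x : 0 <= c * (nsq (T x) - nsq x).
  have [c0|c0] := leP 0 c; first by rewrite mulr_ge0 // subr_ge0.
  have := Ac (T x); have := A0 (T x); have := expT x; have := nsq_ge0 x; nra.
have [|||C [P [bC _ CE _ [Cle _]]]] := @douglas R H _ _ (fun x => d (T x))
    (fun x => J0 s (d x) + J1 s (q x)).
- exact: bop_comp.
- by apply: bopD; [exact: bop_comp (bop_J0 s) bd | exact: bop_comp (bop_J1 s) bq].
- by move=> x; rewrite J_nsq !dE qE; have := c0 x; lra.
pose G1 g := P0 s (C g); pose G2 g := P1 s (C g).
have bG1 : bop G1 by exact: bop_comp (bop_P0 s) bC.
have bG2 : bop G2 by exact: bop_comp (bop_P1 s) bC.
have G_le g : nsq (G1 g) + nsq (G2 g) <= nsq g.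
  rewrite -nsq_decomp; have := Cle g; have := nsq_ge0 (P g); lra.
have tele g n : sqsum (fun k => G2 (iter k G1 g)) n + nsq (iter n G1 g) <= nsq g.
  elim: n => [|n IH]; first by rewrite /sqsum big_ord0 add0r.
  apply: le_trans IH; rewrite /sqsum big_ord_recr /= -addrA lerD2l addrC.
  exact: G_le.
have sum_le g n : sqsum (fun k => G2 (iter k G1 g)) n <= nsq g.
  by apply: le_trans (tele g n); rewrite lerDl nsq_ge0.
have biter k : bop (fun x => G2 (iter k G1 (d x))).
  apply: (bop_comp (f := G2) (g := fun x => iter k G1 (d x))) bG2 _.
  elim: k => [|k IH] /=; first exact: bd.
  exact: (bop_comp (f := G1) (g := fun x => iter k G1 (d x))) bG1 IH.
have [ld [M dM]] := bd.
have [||W bW WE] := @column_map R _ H (fun k x => G2 (iter k G1 (d x))) M.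
- by move=> k; have [] := biter k.
- by move=> h n; apply: le_trans (sum_le _ _) (dM h).
have W_le x : nsq (W x) <= nsq (d x).
  apply: nsq_l2_le => n; apply: le_trans (sum_le (d x) n).
  by rewrite le_eqVlt; apply/orP; left; apply/eqP/eq_bigr => k _; rewrite WE.
have WT x : nsq (W (T x)) = nsq (q x) + nsq (W x).
  rewrite (@nsq_l2_shift _ (W (T x)) (W x)) => [|k]; last first.
    by rewrite !WE iterSr /G1 CE P0E.
  by rewrite WE /= /G2 CE P1E.
exists (fun x => A x + adj W (W x)); split.
- exact: posopD pA (posop_gram bW).
- by move=> x; rewrite !ripDl !(gram_rip _ bW) WT qE addrA subrKC.
- by move=> x; rewrite ripDl (gram_rip _ bW) lerDl nsq_ge0.
- by move=> x; rewrite ripDl (gram_rip _ bW) -lerBrDl -dE.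
Qed.

End PosopAlgebra.

(** * The operator norm and the operator order *)

Section OperatorNorm.
Variable R : realType.
Implicit Types H K L : hilbertType R.

Lemma Re_norm H (x : H) : complex.Re `|x| = Num.sqrt (nsq x).
Proof. by rewrite norm_sqrt. Qed.

Lemma norm_le1 H (x : H) : (`|x| <= 1) = (nsq x <= 1).
Proof.
rewrite norm_sqrt -(rmorph1 (real_complex R)) lecR -[in LHS]sqrtr1.
by rewrite ler_sqrt // ltr01.
Qed.

Lemma opnorm_le H K (f : H -> K) (M : R) : 0 <= M ->
  (forall x, nsq (f x) <= M ^+ 2 * nsq x) -> opnorm f <= M.
Proof.
move=> M0 fM; apply: ge_sup.
  by exists (complex.Re `|f 0|), 0; rewrite //= normr0.
move=> _ [x /= x1 <-]; rewrite norm_le1 in x1; rewrite Re_norm.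
rewrite -(@ger0_norm _ M) // -sqrtr_sqr; apply: ler_wsqrtr.
apply: le_trans (fM x) _; rewrite -[leRHS]mulr1 ler_wpM2l ?sqr_ge0 //.
Qed.

Lemma opnormP H K (f : H -> K) : bop f -> 0 <= opnorm f /\
  forall x, nsq (f x) <= opnorm f ^+ 2 * nsq x.
Proof.
move=> [lf [M hM]].
have ub : has_ubound [set complex.Re `|f x| | x in [set x : H | `|x| <= 1]].
  exists (Num.sqrt `|M|) => _ [x /= x1 <-]; rewrite norm_le1 in x1.
  rewrite Re_norm; apply: ler_wsqrtr; apply: le_trans (hM x) _.
  apply: (@le_trans _ _ (`|M| * nsq x)).
    by rewrite ler_wpM2r ?nsq_ge0 ?ler_norm.
  by rewrite -[leRHS]mulr1 ler_wpM2l.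
have le x : nsq x <= 1 -> Num.sqrt (nsq (f x)) <= opnorm f.
  move=> x1; apply: (ub_le_sup ub); exists x; last by rewrite Re_norm.
  by rewrite /= norm_le1.
have op0 : 0 <= opnorm f.
  by apply: le_trans (le 0 _); rewrite ?sqrtr_ge0 // /nsq rip0l.
split=> // x; have [x0|x0] := eqVneq (nsq x) 0.
  by move/nsq_eq0: (x0) => ->; rewrite (lin0 lf) /nsq !rip0l mulr0.
have xp : 0 < nsq x by rewrite lt_def x0 nsq_ge0.
pose t := (Num.sqrt (nsq x))^-1.
have t2 : t ^+ 2 = (nsq x)^-1 by rewrite exprVn sqr_sqrtr // ltW.
have := le (t%:C *: x); rewrite (linZ lf) !nsqZ t2 mulVf // => /(_ (lexx _)).
rewrite -(@ler_pXn2r _ 2) ?nnegrE ?sqrtr_ge0 // sqr_sqrtr; last first.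
  by rewrite mulr_ge0 ?nsq_ge0 // invr_ge0 ltW.
by rewrite mulrC ler_pdivrMr.
Qed.

Lemma le_opnorm H (A : H -> H) : bop A ->
  forall x, rip (A x) x <= opnorm A * nsq x.
Proof.
move=> bA x; have [p0 pM] := opnormP bA.
have [r0|r0] := leP (rip (A x) x) 0.
  by apply: le_trans r0 _; rewrite mulr_ge0 ?nsq_ge0.
rewrite -(@ler_pXn2r _ 2) ?nnegrE ?(ltW r0) ?mulr_ge0 ?nsq_ge0 //.
apply: le_trans (rip_CS _ _) _; rewrite exprMn [X in _ <= _ * X]expr2 mulrA.
by rewrite ler_wpM2r ?nsq_ge0.
Qed.

Lemma complex_ge0 (z : R[i]) : 0 <= z <-> complex.Im z = 0 /\ 0 <= complex.Re z.
Proof.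
rewrite lecE /=; split=> [/andP[/eqP-> ->]//|[-> ->]].
by rewrite eqxx.
Qed.

Lemma op_leP H (A B : H -> H) : bop A -> bop B ->
  op_le A B <-> posop (fun x => B x - A x).
Proof.
move=> bA bB; have bBA := bopB bB bA; split=> [h|[_ h0 hs] x].
  have hh x := (complex_ge0 _).1 (h x).
  apply: posopI => // [x y|x]; last by have [] := hh x.
  by apply: (symmetric_of_real (A := fun x => B x - A x)) => [|z]; [case: bBA | case: (hh z)].
apply/complex_ge0; split; last exact: h0.
rewrite ipE /=; have := hs x ('i *: x); rewrite (linZ bBA.1).
by rewrite -[rip x _]opprK -ripil ripC; lra.
Qed.

End OperatorNorm.

(** * Block-triangular extensions *)

Section BlockExtension.
Variable R : realType.
Implicit Types H K L : hilbertType R.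

Lemma bop_Delta H (T : H -> H) : bop T -> bop (Delta T).
Proof. move=> bT; exact: bopB (bop_comp (bop_adj bT) bT) (bop_id _). Qed.

Lemma Delta_rip H (T : H -> H) x y : bop T ->
  rip (Delta T x) y = rip (T x) (T y) - rip x y.
Proof. by move=> bT; rewrite /Delta /= ripBl rip_adj. Qed.

Lemma posop_Delta H (T : H -> H) : bop T -> (forall x, nsq x <= nsq (T x)) ->
  posop (Delta T).
Proof.
move=> bT expT; apply: posopB (posop_gram bT) (posop_id H) _ => x.
by rewrite (gram_rip _ bT); exact: expT.
Qed.

(** The Halmos dilation of an isometry [W] on [L] is a unitary operator on the
    sum of two copies of [L] which extends [W]. *)
Lemma unitary_extension L (s : splitting L) (W : L -> L) :
  bop W -> (forall x, nsq (W x) = nsq x) ->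
  exists U : L -> L, [/\ bop U, is_unitary_op U & forall g, U (J0 s g) = J0 s (W g)].
Proof.
move=> bW isoW; have bWs := bop_adj bW.
have WsW x : adj W (W x) = x.
  by apply: (adj_eq bW) => y; rewrite (isometry_rip bW.1 isoW).
pose U w := J0 s (W (P0 s w) + (P1 s w - W (adj W (P1 s w)))) + J1 s (adj W (P1 s w)).
pose V w := J0 s (adj W (P0 s w)) +
  J1 s ((P0 s w - W (adj W (P0 s w))) + W (P1 s w)).
have bU : bop U.
  have b1 := bop_comp bWs (bop_P1 s).
  apply: bopD; last exact: (bop_comp (g := fun w => adj W (P1 s w)) (bop_J1 s) b1).
  apply: (bop_comp (g := fun w => W (P0 s w) + (P1 s w - W (adj W (P1 s w))))
    (bop_J0 s)).
  apply: bopD; first exact: bop_comp bW (bop_P0 s).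
  apply: bopB; first exact: bop_P1.
  exact: (bop_comp (g := fun w => adj W (P1 s w)) bW b1).
have isoU w : nsq (U w) = nsq w.
  rewrite /U J_nsq; set g := P0 s w; set x := P1 s w; set y := adj W x.
  have orth : rip (W g) (x - W y) = 0.
    by rewrite ripBr (isometry_rip bW.1 isoW) /y -adj_rip // subrr.
  have xy : rip x (W y) = nsq y by rewrite -rip_adj.
  by rewrite nsqD orth nsqB !isoW xy (nsq_decomp s w) -/g -/x; ring.
have UV w : U (V w) = w.
  rewrite /U /V P0E P1E (linD bWs.1) (linB bWs.1) !WsW subrr add0r.
  rewrite addrK [_ + (_ - _)]addrC subrK; exact: J_decomp.
have UsU w : adj U (U w) = w.
  by apply: (adj_eq bU) => y; rewrite (isometry_rip bU.1 isoU).
have UsV w : adj U w = V w by rewrite -{1}(UV w) UsU.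
exists U; split=> //; first by split=> w /=; [exact: UsU | rewrite UsV UV].
by move=> g; rewrite /U P0J0 P1J0 (lin0 bWs.1) (lin0 bW.1) subr0 addr0 J10 addr0.
Qed.

(** With [B = A / delta^2] let [B = Z1^* Z1], [1 - B = Z0^* Z0] and
    [Delta T = d^* d]. Invariance of [B] makes [Z1 h |-> Z1 T h] isometric; its
    unitary extension is [U]. Since
    [||Z0 T h||^2 = ||T h||^2 - <B h, h> = ||Z0 h||^2 + ||d h||^2],
    the map [(Z0 h, d h) |-> Z0 T h] is isometric as well. An isometric extension
    [Psi] of it gives [V] on the first component, and on the second one an
    isometry whose range is orthogonal to that of [V]. Finally
    [d = delta C Z1] for a contraction [C], because [Delta T <= A = delta^2 B],
    and [E] is [C] followed by [Psi] on the second component. *)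
Lemma block_extension_of_majorant H (T : 'B(H)) (A : H -> H) (delta : R) :
  0 <= delta -> posop A ->
  (forall x, nsq x <= nsq (T x)) ->
  (forall x, rip (A (T x)) (T x) = rip (A x) x) ->
  (forall x, nsq (T x) - nsq x <= rip (A x) x) ->
  (forall x, rip (A x) x <= delta ^+ 2 * nsq x) ->
  has_block_extension T delta.
Proof.
move=> d0 pA expT invA TA Ad; have bT := boundedOp_bop T.
have [_ A0 _] := pA.
(* If delta = 0 then A = 0 as a form, and B = 0 still satisfies BE below. *)
pose B x := ((delta ^+ 2)^-1)%:C *: A x.
have pB : posop B by apply: posopZ pA; rewrite invr_ge0 sqr_ge0.
have BE x : delta ^+ 2 * rip (B x) x = rip (A x) x.
  rewrite ripZl; have [z|nz] := eqVneq (delta ^+ 2) 0; last by rewrite mulVKf.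
  by apply/eqP; rewrite z mul0r eq_le A0; have := Ad x; rewrite z mul0r => ->.
have invB x : rip (B (T x)) (T x) = rip (B x) x by rewrite !ripZl invA.
have B1 x : rip (B x) x <= nsq x.
  have [z|nz] := eqVneq (delta ^+ 2) 0.
    by rewrite ripZl z invr0 mul0r nsq_ge0.
  have dp : 0 < delta ^+ 2 by rewrite lt_def nz sqr_ge0.
  by rewrite -(ler_pM2l dp) BE.
have [Z1 bZ1 Z1E] := factor pB.
have [Z0 bZ0 Z0E] := factor (posopB (posop_id H) pB B1).
have {}Z0E x : nsq (Z0 x) = nsq x - rip (B x) x by rewrite Z0E ripBl.
have pD := posop_Delta bT expT.
have DE x : rip (Delta T x) x = nsq (T x) - nsq x by rewrite Delta_rip.
have [d bd dE] := factor pD.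
have [s _] := l2_splitting H.
have bJ0 := bop_J0 s; have bJ1 := bop_J1 s.
have bP0 := bop_P0 s; have bP1 := bop_P1 s.
have bZd : bop (fun x => J0 s (Z0 x) + J1 s (d x)).
  by apply: bopD; [exact: bop_comp bJ0 bZ0 | exact: bop_comp bJ1 bd].
have [|Psi [bPsi PsiE PsiN]] := isometry_extension s bZd (bop_comp bZ0 bT).
  by move=> x; rewrite J_nsq !Z0E dE DE invB; ring.
have [|Psi1 [bPsi1 Psi1E Psi1N]] := isometry_extension s bZ1 (bop_comp bZ1 bT).
  by move=> x; rewrite !Z1E invB.
(* The isometry Psi1 extends Z1 h |-> J0 (Z1 (T h)), hence this one extends
   J0 (Z1 h) |-> J0 (Z1 (T h)). *)
have bW : bop (fun w => Psi1 (P0 s w) + J1 s (J1 s (P1 s w))).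
  apply: bopD; first exact: bop_comp bPsi1 bP0.
  by apply: (bop_comp (g := fun w => J1 s (P1 s w)) bJ1); exact: bop_comp bJ1 bP1.
have [|U [bU unitU UJ0]] := unitary_extension s bW.
  by move=> x; rewrite Psi1N -nsq_decomp.
have bZ1' : bop (fun x => J0 s (J0 s (Z1 x))).
  by apply: (bop_comp (g := fun x => J0 s (Z1 x)) bJ0); exact: bop_comp bJ0 bZ1.
have [|C [P [bC _ CE _ [Cle _]]]] := douglas (bopZ delta bZ1') bd.
  by move=> x; rewrite nsqZ !J0_nsq Z1E BE dE DE; exact: TA.
have Psi_rip g x g' x' : rip (Psi g + J1 s (J1 s x)) (Psi g' + J1 s (J1 s x')) =
    rip g g' + rip x x'.
  by rewrite !rip_nsq addrACA -(linD bPsi.1) -!(linD (J1_lin s)) !PsiN; field.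
pose V w := Psi (J0 s (P0 s w)) + J1 s (J1 s (P1 s w)).
have bV : bop V.
  apply: bopD.
    by apply: (bop_comp (g := fun w => J0 s (P0 s w)) bPsi); exact: bop_comp bJ0 bP0.
  by apply: (bop_comp (g := fun w => J1 s (P1 s w)) bJ1); exact: bop_comp bJ1 bP1.
have isoV w : nsq (V w) = nsq w by rewrite PsiN J0_nsq -nsq_decomp.
pose E y := Psi (J1 s (C y)).
have bE : bop E.
  by apply: (bop_comp (g := fun w => J1 s (C w)) bPsi); exact: bop_comp bJ1 bC.
have E0 y : E y = Psi (J1 s (C y)) + J1 s (J1 s 0) by rewrite !J10 addr0.
have nsqE y : nsq (E y) <= nsq y.
  rewrite E0 PsiN J1_nsq {2}/nsq rip0l addr0.
  by apply: le_trans (Cle y); rewrite lerDl nsq_ge0.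
pose T' w := J0 s (V (P0 s w) + delta%:C *: E (P1 s w)) + J1 s (U (P1 s w)).
have bT' : bop T'.
  apply: bopD; last exact: (bop_comp (g := fun w => U (P1 s w)) bJ1 (bop_comp bU bP1)).
  apply: (bop_comp (g := fun w => V (P0 s w) + delta%:C *: E (P1 s w)) bJ0).
  by apply: bopD; [exact: bop_comp bV bP0 | apply: bopZ; exact: bop_comp bE bP1].
pose Z x := J0 s (J0 s (Z0 x)) + J1 s (J0 s (J0 s (Z1 x))).
have bZ : bop Z.
  apply: bopD; last exact: (bop_comp (g := fun x => J0 s (J0 s (Z1 x))) bJ1 bZ1').
  by apply: (bop_comp (g := fun x => J0 s (Z0 x)) bJ0); exact: bop_comp bJ0 bZ0.
exists (l2 H), (l2 H), (l2 H), (toB bJ0), (toB bJ1), (toB bT'), (toB bV), (toB bE), (toB bU).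
split; last split.
- exists (toB bZ); split=> [|x] /=.
    by apply/is_isometryP => x; rewrite /= J_nsq !J0_nsq Z0E Z1E subrK.
  rewrite /T' /Z P0E P1E UJ0 P0J0 P1J0 !J10 addr0 Psi1E.
  rewrite /V P0J0 P1J0 !J10 addr0 /E.
  rewrite -(linZ bPsi.1) -(linZ (J1_lin s)) -(linZ bC.1) CE.
  by rewrite -(linD bPsi.1) PsiE.
- split=> [|||k].
  + by apply/is_isometryP => x; exact: J0_nsq.
  + by apply/is_isometryP => x; exact: J1_nsq.
  + by move=> x y; rewrite ipE /= -(linZ (J1_lin s)) !J01_rip.
  + by exists (P0 s k), (P1 s k); rewrite /= J_decomp.
- by move=> x y; rewrite /= /T' P0E P1E.
- by apply/is_isometryP => x; exact: isoV.
- exact: unitU.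
- by apply: opnorm_le => // x; rewrite expr1n mul1r; exact: nsqE.
- move=> y /=; apply: (adj_eq bV) => x; by rewrite E0 Psi_rip J01_rip !rip0r addr0.
- rewrite -(ger0_norm d0) -sqrtr_sqr; apply: ler_wsqrtr.
  apply: opnorm_le; first exact: sqr_ge0.
  move=> x; have Dd z : rip (Delta T z) z <= delta ^+ 2 * nsq z.
    by rewrite DE; apply: le_trans (TA z) (Ad z).
  apply: le_trans (posop_sq_le pD Dd x) _.
  by rewrite [(delta ^+ 2) ^+ 2]expr2 -mulrA ler_wpM2l ?sqr_ge0.
Qed.

(** The majorant is [delta^2] times the compression to [H] of the projection onto
    the second component, on which [T'] acts by the unitary [U]. *)
Lemma majorant_of_block_extension H (T : 'B(H)) (delta : R) :
  has_block_extension T delta ->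
  exists A : H -> H, [/\ posop A,
    forall x, rip (A (T x)) (T x) = rip (A x) x,
    forall x, nsq x <= nsq (T x) &
    forall x, nsq (T x) - nsq x <= rip (A x) x].
Proof.
move=> [K0 [K1 [K [J0' [J1' [T' [V [E [U]]]]]]]]].
move=> [[Z [/is_isometryP isoZ ZT]] [/is_isometryP iso0 /is_isometryP iso1 o01 surj] blockT].
move=> [/is_isometryP isoV [UsU _] Ele VE0 deltaT].
have [bZ bJ0 bJ1] : [/\ bop Z, bop J0' & bop J1'] by split; exact: boundedOp_bop.
have [bV bE bU] : [/\ bop V, bop E & bop U] by split; exact: boundedOp_bop.
have r01 x y : rip (J0' x) (J1' y) = 0 by rewrite /rip o01.
have JN x y : nsq (J0' x + J1' y) = nsq x + nsq y.
  by rewrite nsqD r01 iso0 iso1 mulr0 addr0.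
have P1J x y : adj J1' (J0' x + J1' y) = y.
  apply: (adj_eq bJ1) => z; rewrite ripDr ripC r01 add0r.
  exact: isometry_rip bJ1.1 iso1 _ _.
have nsqU y : nsq (U y) = nsq y.
  by rewrite /nsq adj_rip // -[adj U (U y)]/((adj U \o U) y) UsU.
have VE x y : rip (V x) (E y) = 0.
  by rewrite adj_rip // -[adj V (E y)]/((adj V \o E) y) VE0 rip0r.
have nsqE y : nsq (E y) <= nsq y.
  have [p0 pM] := opnormP bE; apply: le_trans (pM y) _.
  by rewrite -[leRHS]mul1r ler_wpM2r ?nsq_ge0 // expr_le1.
pose W x := delta%:C *: adj J1' (Z x).
have bW : bop W by apply: bopZ; exact: bop_comp (bop_adj bJ1) bZ.
have key x : exists u y, [/\ Z x = J0' u + J1' y, nsq x = nsq u + nsq y &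
    Z (T x) = J0' (V u + delta%:C *: E y) + J1' (U y)].
  have [u [y Zx]] := surj (Z x); exists u, y; split=> //.
    by rewrite -(isoZ x) Zx JN.
  by rewrite -[Z (T x)]/((Z \o T) x) ZT /= Zx blockT.
have nsqT x : exists y, [/\ adj J1' (Z x) = y, adj J1' (Z (T x)) = U y &
    nsq (T x) = nsq x + delta ^+ 2 * nsq (E y)].
  have [u [y [Zx nx ZTx]]] := key x; exists y; split.
  - by rewrite Zx P1J.
  - by rewrite ZTx P1J.
  - by rewrite -(isoZ (T x)) ZTx JN nsqD nsqZ isoV ripZr VE nsqU nx; ring.
exists (fun x => adj W (W x)); split.
- exact: posop_gram.
- move=> x /=; rewrite !(gram_rip _ bW) /W !nsqZ.
  by have [y [-> -> _]] := nsqT x; rewrite nsqU.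
- by move=> x; have [y [_ _ ->]] := nsqT x; rewrite lerDl mulr_ge0 ?sqr_ge0 ?nsq_ge0.
- move=> x /=; rewrite (gram_rip _ bW) /W nsqZ.
  have [y [-> _ ->]] := nsqT x; rewrite addrC addKr.
  by rewrite ler_wpM2l ?sqr_ge0.
Qed.

End BlockExtension.

(** * Closed subspaces and minimal liftings *)

Section ClosedSubspaces.
Variable R : realType.
Implicit Types H K L : hilbertType R.

Lemma submodP K (M : set K) : GRing.submod_closed [in M] <->
  M 0 /\ forall a x y, M x -> M y -> M (a *: x + y).
Proof.
split=> [[M0 ML]|[M0 ML]]; split.
- exact: set_mem M0.
- by move=> a x y /mem_set Mx /mem_set My; exact: set_mem (ML a x y Mx My).
- exact: mem_set.
- by move=> a x y /set_mem Mx /set_mem My; exact/mem_set/ML.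
Qed.

Lemma closed_span_closed K (X : set K) : closed_subspace (closed_span X).
Proof.
split.
  apply/submodP; split=> [N [[/submodP[N0 _] _] _]//|a x y Mx My N CN].
  have [[/submodP[_ NL] _] _] := CN.
  by apply: NL; [exact: Mx | exact: My].
apply/closed_nsqP => x hx N CN; have [[_ /closed_nsqP cN] _] := CN.
by apply: cN => e /hx[y My xy]; exists y => //; exact: My.
Qed.

Lemma closed_subspace_hilbert K (M : set K) : closed_subspace M ->
  exists (L : hilbertType R) (i : L -> K), [/\ linear i,
    forall x, nsq (i x) = nsq x, forall x, M (i x) &
    forall y, M y -> exists x, i x = y].
Proof.
move=> [sM cM].
pose V : lmodType R[i] := sub_of sM.
pose f (x y : V) := rip (sub_val x) (sub_val y).
have fcomplete (u : nat -> V) :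
    (forall e : R, 0 < e -> exists N, forall m n, (N <= m)%N -> (N <= n)%N ->
       f (u m - u n) (u m - u n) < e) ->
    exists l, forall e : R, 0 < e ->
      exists N, forall n, (N <= n)%N -> f (u n - l) (u n - l) < e.
  move=> hu; have [|l hl] := @nsq_complete R K (fun n => sub_val (u n)).
    by move=> e /hu.
  have Ml : M l.
    apply: ((closed_nsqP M).1 cM) => e /hl[N hN].
    exists (sub_val (u N)); first exact: sub_valP.
    by rewrite nsq_subC; exact: hN.
  by exists (to_sub sM Ml) => e /hl.
have fDl x y z : f (x + y) z = f x z + f y z by exact: ripDl.
have fC x y : f x y = f y x by exact: ripC.
have fZl (c : R) x y : f (c%:C *: x) y = c * f x y by exact: ripZl.
have fii x y : f ('i *: x) ('i *: y) = f x y by exact: ripii.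
have f_ge0 x : 0 <= f x x by exact: nsq_ge0.
have f_eq0 x : f x x = 0 -> x = 0 by move=> /nsq_eq0 h; exact: sub_val_inj.
exists (hilb (RealIP fDl fC fZl fii f_ge0 f_eq0 fcomplete)), (@sub_val _ _ _ sM).
by split=> // [x|y My]; [exact: sub_valP | exists (to_sub sM My)].
Qed.

(** Restricting [S] to the smallest closed invariant subspace containing the
    range of [J] makes a lifting minimal. *)
Lemma cyclic_restriction H K (J : H -> K) (S : K -> K) : bop J -> bop S ->
  exists (L : hilbertType R) (i : L -> K) (J' : H -> L) (S' : L -> L),
    [/\ linear i, forall x, nsq (i x) = nsq x, bop J' /\ bop S',
      (forall h, i (J' h) = J h) /\ (forall x, i (S' x) = S (i x)) &
      minimal_lifting J' S'].
Proof.
move=> bJ bS; have [lJ _] := bJ; have [lS [m hm]] := bS.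
pose X := \bigcup_n (iter n S @` range J).
have XJ h : X (J h) by exists 0%N => //; exists (J h) => //; exists h.
have XS x : X x -> X (S x).
  by move=> [n _ [y Jy <-]]; exists n.+1 => //; exists y.
have cM := closed_span_closed X; set M := closed_span X in cM.
have [sM clM] := cM; have [M0 ML] := (submodP M).1 sM.
have XM x : X x -> M x by move=> Xx N [_ XN]; exact: XN.
have MS x : M x -> M (S x).
  move=> Mx; apply: (Mx [set y | M (S y)]); split; last by move=> y /XS/XM.
  split.
    apply/submodP; split=> [|a y z My Mz] /=; first by rewrite (lin0 lS).
    by rewrite lS; exact: ML.
  apply/closed_nsqP => y hy; apply: ((closed_nsqP M).1 clM) => e e0.
  have m0 : 0 < `|m| + 1 by rewrite ltr_wpDl.
  have [z Mz yz] := hy _ (divr_gt0 e0 m0).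
  exists (S z) => //; rewrite -(linB lS); apply: le_lt_trans (hm _) _.
  rewrite ltr_pdivlMr // in yz; apply: le_lt_trans yz; rewrite mulrC.
  by rewrite ler_wpM2l ?nsq_ge0 //; have := ler_norm m; lra.
have [L [i [li isoi iM Mi]]] := closed_subspace_hilbert cM.
have inj : injective i.
  move=> x y e; apply/eqP; rewrite -subr_eq0; apply/eqP/nsq_eq0.
  by rewrite -isoi (linB li) e subrr /nsq rip0l.
have [J' J'E] := choice (fun h => Mi _ (XM _ (XJ h))).
have [S' S'E] := choice (fun x => Mi _ (MS _ (iM x))).
exists L, i, J', S'; split=> //.
  split.
    have [_ [N hN]] := bJ; apply: (@bopI _ _ _ _ N) => [a x y|x].
      by apply: inj; rewrite li !J'E lJ.
    by rewrite -isoi J'E; exact: hN.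
  apply: (@bopI _ _ _ _ m) => [a x y|x].
    by apply: inj; rewrite li !S'E li lS.
  by rewrite -isoi S'E -[nsq x]isoi; exact: hm.
apply/seteqP; split=> // x _ N [[/submodP[N0 NL] /closed_nsqP clN] XN].
(* The image of a closed subspace N under the isometry i is a closed subspace of
   K, so it contains the closed span of the orbit. *)
suff [z Nz /inj <-//] : exists2 z, N z & i z = i x.
apply: (iM x [set y | exists2 z, N z & i z = y]); split.
  split.
    apply/submodP; split=> [|a _ _ [z Nz <-] [w Nw <-]].
      by exists 0 => //; exact: lin0 li.
    by exists (a *: z + w); [exact: NL | exact: li].
  apply/closed_nsqP => y hy.
  have My : M y.
    apply: ((closed_nsqP M).1 clM) => e /hy[_ [z _ <-] yz].
    by exists (i z).
  have [z zy] := Mi _ My; exists z => //; apply: clN => e /hy[_ [w Nw <-] yw].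
  by exists w => //; rewrite -isoi (linB li) zy.
move=> _ [n _ [_ [h _ <-] <-]].
exists (iter n S' (J' h)).
  by apply: XN; exists n => //; exists (J' h) => //; exists h.
by elim: n => [|n IH] /=; rewrite ?J'E // S'E IH.
Qed.

End ClosedSubspaces.

(** * Liftings of type I *)

Section Liftings.
Variable R : realType.
Implicit Types H K L : hilbertType R.

Lemma nsq_adj_isometry H K (J : H -> K) u : bop J -> (forall x, nsq (J x) = nsq x) ->
  nsq (u - J (adj J u)) = nsq u - nsq (adj J u).
Proof. by move=> bJ iJ; rewrite nsqB iJ -rip_adj // -/(nsq _); ring. Qed.

Lemma adj_isometryK H K (J : H -> K) x : bop J -> (forall x, nsq (J x) = nsq x) ->
  adj J (J x) = x.
Proof.
by move=> bJ iJ; apply: (adj_eq bJ) => y; exact: isometry_rip bJ.1 iJ _ _.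
Qed.

(** The majorant is the compression [J^* (Delta S) J]. It dominates [Delta T]
    since [T] is the compression of [S], and it is invariant under [T]: the
    part of [S J h] orthogonal to [J H] is annihilated by [Delta S], and
    [S^* (Delta S) S = Delta S] for a 2-isometry. *)
Lemma majorant_of_lifting H (T : 'B(H)) : (forall x, nsq x <= nsq (T x)) ->
  has_min_2iso_lifting_type_I T ->
  exists A : H -> H, [/\ posop A,
    forall x, rip (A (T x)) (T x) = rip (A x) x &
    forall x, nsq (T x) - nsq x <= rip (A x) x].
Proof.
move=> expT [K [J [S [/is_isometryP iJ lift S2 _ typeI]]]].
have bJ := boundedOp_bop J; have bS := boundedOp_bop S.
have liftE x : adj J (S (J x)) = T x.
  by rewrite -[LHS]/((adj J \o S) (J x)) lift /= adj_isometryK.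
have two x : nsq (S (S x)) - nsq (S x) = nsq (S x) - nsq x.
  have := congr1 (fun y => rip y x) (S2 x); rewrite rip0l ripDl ripBl.
  rewrite scaler_nat mulr2n ripDl !rip_adj // -!/(nsq _); lra.
pose A x := adj J (Delta S (J x)).
have AE x y : rip (A x) y = rip (S (J x)) (S (J y)) - rip x y.
  by rewrite rip_adj // Delta_rip // (isometry_rip bJ.1 iJ).
have AEx x : rip (A x) x = nsq (S (J x)) - nsq x by rewrite AE.
have A_ge x : nsq (T x) - nsq x <= rip (A x) x.
  rewrite AEx lerD2r -liftE -subr_ge0 -nsq_adj_isometry //; exact: nsq_ge0.
exists A; split=> //.
  apply: posopI => [|x y|x].
  - apply: (bop_comp (g := fun x => Delta S (J x)) (bop_adj bJ)).
    exact: bop_comp (bop_Delta bS) bJ.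
  - by rewrite AE [RHS]ripC AE ripC (ripC x).
  - by apply: le_trans (A_ge x); rewrite subr_ge0.
move=> x; pose k := S (J x) - J (T x).
have k0 : Delta S k = 0.
  apply: typeI => _ [y _ <-].
  have adjk : adj J k = 0.
    by rewrite (linB (bop_adj bJ).1) liftE adj_isometryK // subrr.
  have h z : rip k (J z) = 0 by rewrite -rip_adj // adjk rip0l.
  by rewrite ipE -(linZ bJ.1) !h.
have SJ : S (J x) = J (T x) + k by rewrite addrC subrK.
have bD := bop_Delta bS.
rewrite [RHS]AEx -(iJ x) -two.
have <- : rip (Delta S (S (J x))) (S (J x)) = nsq (S (S (J x))) - nsq (S (J x)).
  by rewrite Delta_rip.
rewrite SJ (linD bD.1) k0 addr0 ripDr.
have -> : rip (Delta S (J (T x))) k = 0.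
  by rewrite Delta_rip // ripC (ripC _ k) -Delta_rip // k0 rip0l.
by rewrite addr0 /A rip_adj.
Qed.

(** The operator [S] acts as [T] on the copy [J H] of [H],
    adds the component [X h], where [X^*X = A - Delta T], in the orthogonal
    complement, and shifts that complement isometrically into itself. Hence
    [S^*S - 1] is [A] on [J H] and [0] on its complement. *)
Lemma typeI_dilation H (T : 'B(H)) (A : H -> H) : posop A ->
  (forall x, nsq x <= nsq (T x)) ->
  (forall x, nsq (T x) - nsq x <= rip (A x) x) ->
  exists (K : hilbertType R) (J : H -> K) (S : K -> K),
    [/\ bop J /\ bop S, forall h, nsq (J h) = nsq h,
      forall w, adj J (S w) = T (adj J w) &
      forall w, nsq (S w) = nsq w + rip (A (adj J w)) (adj J w)].
Proof.
move=> pA expT TA; have bT := boundedOp_bop T; have [bA A0 As] := pA.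
have pX : posop (fun x => A x - Delta T x).
  by apply: posopB pA (posop_Delta bT expT) _ => x; rewrite Delta_rip //; exact: TA.
have [X bX XE] := factor pX.
have {}XE x : nsq (X x) = rip (A x) x - (nsq (T x) - nsq x).
  by rewrite XE ripBl Delta_rip.
have [i0 li0 isoi] := l2_embed H; have bi := bop_isometry li0 isoi.
have [s _] := l2_splitting H.
have bJ0 := bop_J0 s; have bJ1 := bop_J1 s.
have bP0 := bop_P0 s; have bP1 := bop_P1 s.
pose q w := adj i0 (P0 s w).
have bq : bop q by exact: bop_comp (bop_adj bi) bP0.
pose J h := J0 s (i0 h).
have bJ : bop J by exact: bop_comp bJ0 bi.
have adjJ w : adj J w = q w.
  by apply: (adj_eq bJ) => x; rewrite /q -adj_rip // -adj_rip.
pose S w := J0 s (i0 (T (q w))) +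
  J1 s (J0 s (J0 s (X (q w)) + J1 s (P0 s w - i0 (q w))) + J1 s (P1 s w)).
have bS : bop S.
  apply: bopD.
    apply: (bop_comp (g := fun w => i0 (T (q w))) bJ0).
    by apply: (bop_comp (g := fun w => T (q w)) bi); exact: bop_comp bT bq.
  apply: (bop_comp (g := fun w => J0 s (J0 s (X (q w)) + J1 s (P0 s w - i0 (q w))) +
    J1 s (P1 s w)) bJ1).
  apply: bopD; last exact: bop_comp bJ1 bP1.
  apply: (bop_comp (g := fun w => J0 s (X (q w)) + J1 s (P0 s w - i0 (q w))) bJ0).
  apply: bopD.
    by apply: (bop_comp (g := fun w => X (q w)) bJ0); exact: bop_comp bX bq.
  apply: (bop_comp (g := fun w => P0 s w - i0 (q w)) bJ1).
  by apply: bopB bP0 _; exact: bop_comp bi bq.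
exists (l2 H), J, S; split=> // [h|w|w].
- by rewrite J0_nsq isoi.
- by rewrite !adjJ /q /S P0E adj_isometryK.
- rewrite adjJ /S !J_nsq isoi XE (nsq_adj_isometry _ bi isoi) (nsq_decomp s w).
  rewrite -/(q w); ring.
Qed.

Lemma lifting_of_majorant H (T : 'B(H)) (A : H -> H) : posop A ->
  (forall x, nsq x <= nsq (T x)) ->
  (forall x, rip (A (T x)) (T x) = rip (A x) x) ->
  (forall x, nsq (T x) - nsq x <= rip (A x) x) ->
  has_min_2iso_lifting_type_I T.
Proof.
move=> pA expT invA TA; have bT := boundedOp_bop T; have [bA A0 As] := pA.
have [K [J [S [[bJ bS] isoJ JS SN]]]] := typeI_dilation pA expT TA.
have [L [i [J' [S' [li isoi [bJ' bS'] [iJ iS] min]]]]] := cyclic_restriction bJ bS.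
have adjJ' x : adj J' x = adj J (i x).
  apply: (adj_eq bJ') => h.
  by rewrite -adj_rip // -iJ (isometry_rip li isoi).
pose q := adj J'; have bq : bop q by exact: bop_adj.
have qS x : q (S' x) = T (q x) by rewrite /q !adjJ' iS JS.
have form x y : rip (S' x) (S' y) = rip x y + rip (A (q x)) (q y).
  have S'N z : nsq (S' z) = nsq z + rip (A (q z)) (q z).
    by rewrite -isoi iS SN isoi /q adjJ'.
  rewrite !rip_nsq -(linD bS'.1) !S'N (linD bq.1) (linD bA.1) -!rip_nsq.
  by rewrite !ripDl !ripDr (As (q y) (q x)) (ripC (q y)) [rip x y]rip_nsq; field.
have invq x y : rip (A (q (S' x))) (q (S' y)) = rip (A (q x)) (q y).
  rewrite !qS; have e := invA (q x + q y); move: e.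
  rewrite (linD bT.1) !(linD bA.1) !ripDl !ripDr !invA.
  by rewrite (As (q y) (q x)) (ripC (q y)) (As (T (q y)) (T (q x))) (ripC (T (q y))); lra.
exists L, (toB bJ'), (toB bS'); split=> //.
- by apply/is_isometryP => h; rewrite /= -isoi iJ.
- move=> x; apply: rip_ext => y; rewrite rip0r ripC.
  rewrite ripDl ripBl scaler_nat mulr2n ripDl !rip_adj // !form invq; ring.
- move=> x hx; apply: rip_ext => y; rewrite rip0r ripC Delta_rip // form.
  have -> : q x = 0.
    by apply: (adj_eq bJ') => h; rewrite rip0r ripC /rip hx //; exists h.
  by rewrite (lin0 bA.1) rip0l addr0 subrr.
Qed.

End Liftings.

(** * The equivalence *)

Section Conversions.
Variable R : realType.
Implicit Types H K L : hilbertType R.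

Lemma bop_0 H K : bop (fun _ : H => 0 : K).
Proof.
apply: (@bopI _ _ _ _ 0) => [a x y|x]; first by rewrite scaler0 addr0.
by rewrite mul0r /nsq rip0l.
Qed.

Lemma expansiveP H (T : H -> H) : bop T ->
  expansive T <-> forall x, nsq x <= nsq (T x).
Proof.
move=> bT; have bTT := bop_comp (bop_adj bT) bT.
rewrite /expansive (op_leP (bop_id H) bTT); split=> [[_ h _] x|].
  by have := h x; rewrite ripBl (gram_rip _ bT) subr_ge0.
exact: posop_Delta.
Qed.

Lemma posop_op_le0 H (A : H -> H) : bop A -> op_le \0 A <-> posop A.
Proof.
move=> bA; rewrite (op_leP (bop_0 H H) bA).
by have -> : (fun x => A x - 0) = A by apply/funext => x; rewrite subr0.
Qed.

Lemma A_contractionP H (A T : H -> H) : bop A -> bop T ->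
  A_contraction A T <->
  posop A /\ forall x, rip (A (T x)) (T x) <= rip (A x) x.
Proof.
move=> bA bT; have bTAT : bop (adj T \o A \o T).
  exact: bop_comp (bop_adj bT) (bop_comp bA bT).
rewrite /A_contraction (posop_op_le0 bA) (op_leP bTAT bA); split=> -[pA h]; split=> //.
  by move=> x; have [_ h0 _] := h; have := h0 x; rewrite ripBl rip_adj // subr_ge0.
by apply: posopB pA (posop_conj bT pA) _ => x; rewrite rip_adj.
Qed.

Lemma majorantP H (T A : H -> H) : bop T -> bop A ->
  [/\ A_contraction A T, op_le (Delta T) A & op_le \0 (Delta T)] <->
  [/\ posop A, forall x, nsq x <= nsq (T x),
    forall x, rip (A (T x)) (T x) <= rip (A x) x &
    forall x, nsq (T x) - nsq x <= rip (A x) x].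
Proof.
move=> bT bA; have bD := bop_Delta bT.
split=> [[/(A_contractionP bA bT)[pA cA] /(op_leP bD bA)[_ h _]]|[pA eT cA TA]].
  move=> /(posop_op_le0 bD)[_ D0 _]; split=> // x.
    by have := D0 x; rewrite Delta_rip // subr_ge0.
  by have := h x; rewrite ripBl Delta_rip // subr_ge0.
have pD := posop_Delta bT eT; split; first exact/(A_contractionP bA bT).
  by apply/(op_leP bD bA); apply: posopB pA pD _ => x; rewrite Delta_rip //; exact: TA.
exact/(posop_op_le0 bD).
Qed.

End Conversions.

Theorem theorem3p7 (R : realType) (H : hilbertType R) (T : 'B(H)) :
  [/\ (expansive T /\ has_min_2iso_lifting_type_I T) <->
        (exists A : 'B(H),
           [/\ A_contraction A T, op_le (Delta T) A & op_le \0 (Delta T)]),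
      (exists A : 'B(H),
         [/\ A_contraction A T, op_le (Delta T) A & op_le \0 (Delta T)]) <->
        (exists delta : R, has_block_extension T delta) &
      forall A : 'B(H),
        A_contraction A T -> op_le (Delta T) A -> op_le \0 (Delta T) ->
        has_block_extension T (Num.sqrt (opnorm A))].
Proof.
have bT := boundedOp_bop T.
pose majorant (A : 'B(H)) :=
  [/\ A_contraction A T, op_le (Delta T) A & op_le \0 (Delta T)].
have block (A : 'B(H)) : majorant A -> has_block_extension T (Num.sqrt (opnorm A)).
  move=> /(majorantP bT (boundedOp_bop A))[pA eT cA TA].
  have bA := boundedOp_bop A; have [op0 _] := opnormP bA.
  have [B [pB invB AB Bc]] := invariant_majorant bT pA eT cA (le_opnorm bA).
  apply: block_extension_of_majorant pB eT invB _ _; first exact: sqrtr_ge0.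
    by move=> x; apply: le_trans (TA x) (AB x).
  by move=> x; rewrite sqr_sqrtr.
have unblock delta : has_block_extension T delta -> exists A : 'B(H), majorant A.
  move=> /majorant_of_block_extension[A [pA invA eT TA]].
  have [bA _ _] := pA; exists (toB bA); apply/(majorantP bT bA).
  by split=> // x; rewrite invA.
split.
- split=> [[/(expansiveP bT) eT /(majorant_of_lifting eT)[A [pA invA TA]]]|[A mA]].
    have [bA _ _] := pA; exists (toB bA); apply/(majorantP bT bA).
    by split=> // x; rewrite invA.
  have [B [pB invB eT TB]] := majorant_of_block_extension (block A mA).
  by split; [exact/(expansiveP bT) | exact: lifting_of_majorant pB eT invB TB].
- by split=> [[A mA]|[delta /unblock//]]; exists (Num.sqrt (opnorm A)); exact: block.
- by move=> A h1 h2 h3; exact: block.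
Qed.
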